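(* Given a proof graph $\langle P\mid\Gamma\rangle$ and a cut node $\odot$ in $\Gamma$, there is an equivalent proof graph $\langle P'\mid\Gamma\rangle$ in which that cut node is ready, i.e., can be reduced.
   Context: Write ⅋ for par and $\odot$ for the cut connective. A proof graph $\langle P\mid\Gamma\rangle$ is an MLL linking tree $P$ (generated by $\mathsf1\mid a\otimes a^\perp\mid a^\perp\otimes a\mid\bot\otimes L\mid L\otimes\bot\mid L⅋L$) and a sequent with cuts $\Gamma$ (cuts $A\odot A^\perp$ occur only as roots) with the same leaves, such that every switching (deleting one child edge per ⅋-node; $\odot$ acts like $\otimes$) is connected and acyclic. Equivalence $\sim$ of proof graphs is generated by commutativity/associativity of ⅋ in the linking, commutativity of $\otimes$, $\bot_i\otimes(Q\otimes\bot_j)\sim(\bot_i\otimes Q)\otimes\bot_j$ and $Q⅋(R\otimes\bot_i)\sim(Q⅋R)\otimes\bot_i$ (side condition: in every switching with also the edge from $\bot_i$ to its parent removed, no node of $Q$ is connected to $\bot_i$). The cut reduction steps on graphs are: $\langle P\mid(A⅋B)\odot(B^\perp\otimes A^\perp),\Gamma\rangle\to\langle P\mid A\odot A^\perp,B\odot B^\perp,\Gamma\rangle$; $\langle P[(a_h^\perp\otimes a_i)⅋(a_j^\perp\otimes a_k)]\mid a_i\odot a_j^\perp,\Gamma\rangle\to\langle P[a_h^\perp\otimes a_k]\mid\Gamma\rangle$; $\langle P[(Q\otimes\bot_i)⅋\mathsf1_j]\mid\bot_i\odot\mathsf1_j,\Gamma\rangle\to\langle P[Q]\mid\Gamma\rangle$.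 A cut node is ready in a proof graph if one of these steps applies to it there. *)

(* Defs.v *)
From Stdlib Require Import List Arith Relations Permutation.
Import ListNotations.

Inductive lit : Type := Pos (a : nat) | Neg (a : nat) | One | Bot.

(** Binary trees with leaves labelled by a literal and an occurrence index;
    used both for formulas of the sequent and for linking trees. *)
Inductive tree : Type :=
| Lf (l : lit) (i : nat)
| Tens (s t : tree)
| Par (s t : tree).

Fixpoint leaves (t : tree) : list (lit * nat) :=
  match t with
  | Lf l i => [(l, i)]
  | Tens s u | Par s u => leaves s ++ leaves u
  end.

Fixpoint dualf (A B : tree) : Prop :=
  match A, B with
  | Lf (Pos a) _, Lf (Neg b) _ => a = b
  | Lf (Neg a) _, Lf (Pos b) _ => a = b
  | Lf One _, Lf Bot _ => True
  | Lf Bot _, Lf One _ => True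
  | Tens A1 A2, Par B1 B2 => dualf A1 B2 /\ dualf A2 B1
  | Par A1 A2, Tens B1 B2 => dualf A1 B2 /\ dualf A2 B1
  | _, _ => False
  end.

Inductive linking : tree -> Prop :=
| lk_one i : linking (Lf One i)
| lk_ax1 a i j : linking (Tens (Lf (Pos a) i) (Lf (Neg a) j))
| lk_ax2 a i j : linking (Tens (Lf (Neg a) i) (Lf (Pos a) j))
| lk_botl i L : linking L -> linking (Tens (Lf Bot i) L)
| lk_botr i L : linking L -> linking (Tens L (Lf Bot i))
| lk_par L M : linking L -> linking M -> linking (Par L M).

Inductive item : Type := Form (A : tree) | Cut (A B : tree).

Definition wf_item (it : item) : Prop :=
  match it with Form _ => True | Cut A B => dualf A B end.

Definition item_leaves (it : item) : list (lit * nat) :=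
  match it with Form A => leaves A | Cut A B => leaves A ++ leaves B end.

Definition seq_leaves (G : list item) : list (lit * nat) :=
  flat_map item_leaves G.

(** Vertices of the proof graph: shared leaves (by occurrence index),
    internal nodes of the linking P (by address from the root), and internal
    nodes of the k-th item of the sequent (by address; a cut node is [VG k []]). *)
Inductive vert : Type :=
| VLeaf (i : nat)
| VP (p : list bool)
| VG (k : nat) (p : list bool).

Definition rootv (f : list bool -> vert) (p : list bool) (t : tree) : vert :=
  match t with Lf _ i => VLeaf i | _ => f p end.

Fixpoint tverts (f : list bool -> vert) (p : list bool) (t : tree) : list vert :=
  match t with
  | Lf _ i => [VLeaf i]
  | Tens t1 t2 | Par t1 t2 =>
      f p :: tverts f (p ++ [false]) t1 ++ tverts f (p ++ [true]) t2
  end.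

Fixpoint tedges (f : list bool -> vert) (sw : vert -> bool) (p : list bool)
  (t : tree) : list (vert * vert) :=
  match t with
  | Lf _ _ => []
  | Tens t1 t2 =>
      (f p, rootv f (p ++ [false]) t1) :: (f p, rootv f (p ++ [true]) t2) ::
      tedges f sw (p ++ [false]) t1 ++ tedges f sw (p ++ [true]) t2
  | Par t1 t2 =>
      (if sw (f p) then (f p, rootv f (p ++ [true]) t2)
       else (f p, rootv f (p ++ [false]) t1)) ::
      tedges f sw (p ++ [false]) t1 ++ tedges f sw (p ++ [true]) t2
  end.

Definition iverts (k : nat) (it : item) : list vert :=
  match it with
  | Form A => tverts (VG k) [] A
  | Cut A B => VG k [] :: tverts (VG k) [false] A ++ tverts (VG k) [true] B
  end.

Definition iedges (sw : vert -> bool) (k : nat) (it : item) : list (vert * vert) :=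
  match it with
  | Form A => tedges (VG k) sw [] A
  | Cut A B =>
      (VG k [], rootv (VG k) [false] A) :: (VG k [], rootv (VG k) [true] B) ::
      tedges (VG k) sw [false] A ++ tedges (VG k) sw [true] B
  end.

Fixpoint sverts (k : nat) (G : list item) : list vert :=
  match G with [] => [] | it :: G' => iverts k it ++ sverts (S k) G' end.

Fixpoint sedges (sw : vert -> bool) (k : nat) (G : list item) : list (vert * vert) :=
  match G with [] => [] | it :: G' => iedges sw k it ++ sedges sw (S k) G' end.

Definition pg_verts (P : tree) (G : list item) : list vert :=
  tverts VP [] P ++ sverts 0 G.

Definition pg_edges (sw : vert -> bool) (P : tree) (G : list item) : list (vert * vert) :=
  tedges VP sw [] P ++ sedges sw 0 G.

Definition adj (E : list (vert * vert)) (u v : vert) : Prop :=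
  In (u, v) E \/ In (v, u) E.

Definition connected (V : list vert) (E : list (vert * vert)) : Prop :=
  forall u v, In u V -> In v V -> clos_refl_trans vert (adj E) u v.

Definition is_cycle (E : list (vert * vert)) (c : list vert) : Prop :=
  3 <= length c /\ NoDup c /\
  (forall n, S n < length c -> adj E (nth n c (VLeaf 0)) (nth (S n) c (VLeaf 0))) /\
  adj E (last c (VLeaf 0)) (hd (VLeaf 0) c).

Definition acyclic (E : list (vert * vert)) : Prop :=
  forall c, ~ is_cycle E c.

Definition proof_graph (P : tree) (G : list item) : Prop :=
  linking P /\
  Forall wf_item G /\
  NoDup (map snd (seq_leaves G)) /\
  Permutation (leaves P) (seq_leaves G) /\
  (forall sw : vert -> bool,
      connected (pg_verts P G) (pg_edges sw P G) /\ acyclic (pg_edges sw P G)).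

Inductive ctx : Type :=
| Hole
| CTL (C : ctx) (t : tree)
| CTR (t : tree) (C : ctx)
| CPL (C : ctx) (t : tree)
| CPR (t : tree) (C : ctx).

Fixpoint plug (C : ctx) (t : tree) : tree :=
  match C with
  | Hole => t
  | CTL C' u => Tens (plug C' t) u
  | CTR u C' => Tens u (plug C' t)
  | CPL C' u => Par (plug C' t) u
  | CPR u C' => Par u (plug C' t)
  end.

Fixpoint hole_path (C : ctx) : list bool :=
  match C with
  | Hole => []
  | CTL C' _ | CPL C' _ => false :: hole_path C'
  | CTR _ C' | CPR _ C' => true :: hole_path C'
  end.

Definition adj_minus (E : list (vert * vert)) (x y : vert) (u v : vert) : Prop :=
  adj E u v /\ ~ ((u = x /\ v = y) \/ (u = y /\ v = x)).

(** Side condition of Q ⅋ (R ⊗ ⊥_i) ~ (Q ⅋ R) ⊗ ⊥_i, evaluated in the graph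
    ⟨C[Q ⅋ (R ⊗ ⊥_i)] | Γ⟩: in every switching, with also the edge from ⊥_i to
    its parent (in the linking) removed, no node of Q is connected to ⊥_i. *)
Definition side_cond (G : list item) (C : ctx) (Q R : tree) (i : nat) : Prop :=
  let P := plug C (Par Q (Tens R (Lf Bot i))) in
  forall (sw : vert -> bool) (v : vert),
    In v (tverts VP (hole_path C ++ [false]) Q) ->
    ~ clos_refl_trans vert
        (adj_minus (pg_edges sw P G) (VP (hole_path C ++ [true])) (VLeaf i))
        v (VLeaf i).

Inductive eq_step (G : list item) : tree -> tree -> Prop :=
| es_par_comm C Q R :
    eq_step G (plug C (Par Q R)) (plug C (Par R Q))
| es_par_assoc C Q R S :
    eq_step G (plug C (Par Q (Par R S))) (plug C (Par (Par Q R) S))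
| es_tens_comm C Q R :
    eq_step G (plug C (Tens Q R)) (plug C (Tens R Q))
| es_bot_assoc C Q i j :
    eq_step G (plug C (Tens (Lf Bot i) (Tens Q (Lf Bot j))))
              (plug C (Tens (Tens (Lf Bot i) Q) (Lf Bot j)))
| es_par_bot C Q R i :
    side_cond G C Q R i ->
    eq_step G (plug C (Par Q (Tens R (Lf Bot i))))
              (plug C (Tens (Par Q R) (Lf Bot i))).

Definition pg_equiv (G : list item) (P P' : tree) : Prop :=
  clos_refl_sym_trans tree (eq_step G) P P'.

(** The cut node at position k of Γ is ready in ⟨P | Γ⟩: one of the three
    cut-reduction steps applies to it (the cut A ⊙ A^⊥ being read as unordered). *)
Definition ready (P : tree) (G : list item) (k : nat) : Prop :=
  exists X Y, nth_error G k = Some (Cut X Y) /\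
  (
    (exists A1 A2 B1 B2,
        (X = Par A1 A2 /\ Y = Tens B1 B2) \/ (X = Tens B1 B2 /\ Y = Par A1 A2))
  \/
    (exists a i j,
        ((X = Lf (Pos a) i /\ Y = Lf (Neg a) j) \/ (X = Lf (Neg a) j /\ Y = Lf (Pos a) i)) /\
        exists C h l,
          P = plug C (Par (Tens (Lf (Neg a) h) (Lf (Pos a) i))
                          (Tens (Lf (Neg a) j) (Lf (Pos a) l))))
  \/
    (exists i j,
        ((X = Lf Bot i /\ Y = Lf One j) \/ (X = Lf One j /\ Y = Lf Bot i)) /\
        exists C Q, P = plug C (Par (Tens Q (Lf Bot i)) (Lf One j))) ).

(* Main.v *)
Require Import Defs.
From Stdlib Require Import List Arith Lia Relations Permutation.
Import ListNotations.

(** Contracting every internal node of a switched tree onto one of its leaves turns a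
    proof graph into a statement about spanning trees on the leaves: whatever the
    switching, the collapsed linking together with the collapsed sequent is a spanning
    tree.  Rewriting steps can be checked there, without addresses.

    A bottom can always be pushed inwards, from (Q ⅋ R) ⊗ ⊥ to Q ⅋ (R ⊗ ⊥): if a leaf
    of Q or R were joined to ⊥ without the edge of ⊥, the switching leading from the
    root of Q ⅋ R to the last such leaf on the path would contain a cycle.  Hence every
    linking is equivalent to a ⅋ of ⅋-free blocks.  The two leaves of an atomic or unit
    cut lie in distinct blocks, which can be made siblings.  These two blocks are
    connected in every switching, and joined to each other by the cut, so their bottoms
    can be pulled out again until only the two links (or Q ⊗ ⊥ and 1) are left. *)

(** Rewriting moves subtrees, so the addresses [VP p] of internal nodes change at every step while
    leaf indices do not; hence the comparison on leaves. Its price is that the side condition of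
    [es_par_bot] still speaks of the graph itself: paths found in a collapse have to be lifted back
    to paths that avoid the edge of the bottom. A collapse chooses a representative leaf for each
    node. A proof graph yields trees for every choice of representatives, whereas one choice per
    switching is enough to recognise a proof graph. Hypotheses are therefore used with [nd = true]
    and goals are proved with [nd = false]. Pushing a bottom inwards reads [es_par_bot] backwards,
    and the side condition is evaluated in the result, so that result must first be shown to be a
    proof graph. Pulling a bottom out is not always legitimate; this is why the two blocks must be
    siblings before any bottom leaves them. *)

Notation edge := (vert * vert)%type.

(** * Connectivity and forests *)

Definition conn (E : list edge) : vert -> vert -> Prop := clos_refl_trans vert (adj E).

Lemma conn_edge E a b : In (a, b) E -> conn E a b.
Proof. intros H; apply rt_step; left; exact H. Qed.

Lemma conn_trans E a b c : conn E a b -> conn E b c -> conn E a c.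
Proof. apply rt_trans. Qed.

Lemma clos_rt_sym (R : relation vert) :
  (forall a b, R a b -> R b a) ->
  forall a b, clos_refl_trans vert R a b -> clos_refl_trans vert R b a.
Proof.
  intros HR a b H; induction H.
  - apply rt_step; auto.
  - apply rt_refl.
  - eapply rt_trans; eauto.
Qed.

Lemma conn_sym E a b : conn E a b -> conn E b a.
Proof. apply clos_rt_sym; unfold adj; tauto. Qed.

(** [conn E] is the least equivalence relation containing the edges, so inclusions of connectivity
    are checked edge by edge. [K] will be the connectivity of another edge list, of a contracted
    one, or of a graph with one edge forbidden. *)
Lemma conn_realize (K : relation vert) E :
  equivalence vert K -> (forall e, In e E -> K (fst e) (snd e)) ->
  forall a b, conn E a b -> K a b.
Proof.
  intros [Kr Kt Ks] H a b C; induction C as [a b [C|C]| |].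
  - exact (H _ C).
  - apply Ks, (H _ C).
  - apply Kr.
  - eapply Kt; eauto.
Qed.

Lemma conn_equiv E : equivalence vert (conn E).
Proof.
  split.
  - intros a; apply rt_refl.
  - intros a b c; apply conn_trans.
  - intros a b; apply conn_sym.
Qed.

Lemma conn_incl E E' : incl E E' -> forall a b, conn E a b -> conn E' a b.
Proof.
  intros H; apply conn_realize; [apply conn_equiv|].
  intros [a b] He; apply conn_edge, H, He.
Qed.

(** A path crosses the added edge at most once after shortening: a second crossing leads back to the
    component it started from. The three cases are no crossing and one crossing in either
    direction. *)
Lemma conn_cons E a b x y :
  conn ((a, b) :: E) x y ->
  conn E x y \/ (conn E x a /\ conn E b y) \/ (conn E x b /\ conn E a y).
Proof.
  intros H; apply clos_rt_rtn1 in H; induction H as [|y z Hs H IH].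
  - left; apply rt_refl.
  - destruct Hs as [[Hs|Hs]|[Hs|Hs]].
    + injection Hs as <- <-.
      destruct IH as [IH|[[IH1 IH2]|[IH1 IH2]]]; [right; left| right; left|left];
        try split; auto; apply rt_refl.
    + assert (S : conn E y z) by (apply conn_edge, Hs).
      destruct IH as [IH|[[IH1 IH2]|[IH1 IH2]]];
        [left|right; left; split; [exact IH1|]|right; right; split; [exact IH1|]];
        eapply conn_trans; eauto.
    + injection Hs as <- <-.
      destruct IH as [IH|[[IH1 IH2]|[IH1 IH2]]]; [right; right|left|right; right];
        try split; auto; apply rt_refl.
    + assert (S : conn E y z) by (apply conn_sym, conn_edge, Hs).
      destruct IH as [IH|[[IH1 IH2]|[IH1 IH2]]];
        [left|right; left; split; [exact IH1|]|right; right; split; [exact IH1|]];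
        eapply conn_trans; eauto.
Qed.

Lemma conn_cons_intro E a b x y :
  conn E x y \/ (conn E x a /\ conn E b y) \/ (conn E x b /\ conn E a y) ->
  conn ((a, b) :: E) x y.
Proof.
  assert (I : forall x y, conn E x y -> conn ((a, b) :: E) x y)
    by (apply conn_incl, incl_tl, incl_refl).
  assert (J : conn ((a, b) :: E) a b) by (apply conn_edge; left; auto).
  intros [H|[[H1 H2]|[H1 H2]]]; [apply I, H| |].
  - exact (conn_trans _ _ _ _ (I _ _ H1) (conn_trans _ _ _ _ J (I _ _ H2))).
  - exact (conn_trans _ _ _ _ (I _ _ H1) (conn_trans _ _ _ _ (conn_sym _ _ _ J) (I _ _ H2))).
Qed.

(** Acyclicity without cycles: every edge joins two distinct components of the edges after it.
    Unlike [acyclic], this also excludes loops and repeated edges. *)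
Fixpoint forest (E : list edge) : Prop :=
  match E with
  | [] => True
  | (u, v) :: E' => ~ conn E' u v /\ forest E'
  end.

Lemma forest_perm E E' : Permutation E E' -> forest E -> forest E'.
Proof.
  intros H; induction H as [|[a b] E E' H IH|[a b] [c d] E|]; simpl; auto.
  - intros [H1 H2]; split; auto.
    intros H3; apply H1; revert H3; apply conn_incl.
    intros e; apply Permutation_in, Permutation_sym, H.
  - intros [H1 [H2 H3]]; split; [|split; auto].
    + intros H4; apply conn_cons in H4.
      destruct H4 as [H4|[[H4 H5]|[H4 H5]]]; [contradiction| |];
        apply H1, conn_cons_intro; [right; left|right; right]; auto using conn_sym.
    + intros H4; apply H1; revert H4; apply conn_incl, incl_tl, incl_refl.
Qed.

Lemma forest_bridge E a b E' : forest E -> Permutation E ((a, b) :: E') -> ~ conn E' a b.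
Proof. intros H HP; apply (forest_perm _ _ HP) in H; apply H. Qed.

(** Only vertices of [V] must be connected, while edges may pass through others. Taking the leaves
    for [V], internal nodes can be contracted one at a time with [V] fixed. *)
Definition tree_on (V : vert -> Prop) (E : list edge) : Prop :=
  (forall u v, V u -> V v -> conn E u v) /\ forest E.

Lemma tree_on_perm V E E' : Permutation E E' -> tree_on V E <-> tree_on V E'.
Proof.
  assert (H : forall E E', Permutation E E' -> tree_on V E -> tree_on V E').
  { clear; intros E E' H [H1 H2]; split; [|eapply forest_perm; eauto].
    intros u v Hu Hv; generalize (H1 u v Hu Hv); apply conn_incl.
    intros e; apply Permutation_in, H. }
  intros HP; split; apply H; auto using Permutation_sym.
Qed.

(** An end of an edge may slide along the remaining edges. Both moves of a bottom rest on this, with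
    [b] the bottom and [a], [c] the leaves it hangs from before and after. *)
Lemma tree_on_exchange V E a b c :
  conn E a c -> tree_on V ((a, b) :: E) -> tree_on V ((c, b) :: E).
Proof.
  intros Hac [H1 [H2 H3]]; split.
  - intros u v Hu Hv; generalize (H1 u v Hu Hv); apply conn_realize; [apply conn_equiv|].
    intros e [<-|He]; simpl.
    + eapply conn_trans; [|apply conn_edge; left; reflexivity].
      revert Hac; apply conn_incl, incl_tl, incl_refl.
    + apply conn_edge; right; destruct e; exact He.
  - split; auto. intros H; apply H2; eapply conn_trans; eauto.
Qed.

(** * Contraction of an edge *)

Definition vert_eq_dec (u v : vert) : {u = v} + {u <> v}.
Proof. repeat decide equality. Defined.

Definition subv (w x u : vert) : vert := if vert_eq_dec u w then x else u.
Definition sube (w x : vert) (e : edge) : edge := (subv w x (fst e), subv w x (snd e)).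

Lemma subv_eq w x : subv w x w = x.
Proof. unfold subv; destruct (vert_eq_dec w w); congruence. Qed.

Lemma subv_neq w x u : u <> w -> subv w x u = u.
Proof. unfold subv; destruct (vert_eq_dec u w); congruence. Qed.

Lemma conn_contract w x E u v :
  conn ((w, x) :: E) u v <-> conn (map (sube w x) E) (subv w x u) (subv w x v).
Proof.
  assert (S : forall u, conn ((w, x) :: E) u (subv w x u)).
  { intros u'; unfold subv; destruct (vert_eq_dec u' w) as [->|_];
      [apply conn_edge; left; auto|apply rt_refl]. }
  split.
  - apply (conn_realize (fun u v => conn (map (sube w x) E) (subv w x u) (subv w x v))).
    + split; intros a.
      * apply rt_refl.
      * intros b c; apply conn_trans.
      * intros b; apply conn_sym.
    + intros e [<-|He]; simpl.
      * rewrite subv_eq; unfold subv; destruct (vert_eq_dec x w); apply rt_refl.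
      * apply conn_edge; apply (in_map (sube w x)) in He; exact He.
  - intros H. eapply conn_trans; [apply S|].
    eapply conn_trans; [|apply conn_sym, S].
    revert H; apply conn_realize; [apply conn_equiv|].
    intros e He; apply in_map_iff in He as [[a b] [<- He]]; simpl.
    eapply conn_trans; [apply conn_sym, S|]. eapply conn_trans; [|apply S].
    apply conn_edge; right; exact He.
Qed.

Lemma forest_contract w x E :
  forest ((w, x) :: E) <-> w <> x /\ forest (map (sube w x) E).
Proof.
  assert (M : forall E a b, conn E a b -> conn (map (sube w x) E) (subv w x a) (subv w x b)).
  { intros E' a b H; apply conn_contract; revert H; apply conn_incl, incl_tl, incl_refl. }
  split.
  - intros H; split.
    + intros ->; apply H, rt_refl.
    + induction E as [|[a b] E IH]; simpl; auto.
      apply (forest_perm _ ((a, b) :: (w, x) :: E)) in H; [|apply perm_swap].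
      destruct H as [H1 H2]; split; auto.
      intros H; apply H1, conn_contract, H.
  - intros [Hn H]; split.
    + induction E as [|[a b] E IH]; simpl in H.
      * intros C; apply clos_rt_rt1n in C; destruct C as [|y z [[]|[]]]; auto.
      * destruct H as [H1 H2]; intros C; apply conn_cons in C.
        assert (Ex : subv w x x = x) by (unfold subv; destruct (vert_eq_dec x w); auto).
        destruct C as [C|[[C1 C2]|[C1 C2]]]; [exact (IH H2 C)| |];
          apply M in C1; apply M in C2; rewrite subv_eq in C1; rewrite Ex in C2;
          apply H1; [apply conn_sym in C1, C2|]; eapply conn_trans; eauto.
    + induction E as [|[a b] E IH]; simpl in *; auto.
      destruct H as [H1 H2]; split; auto.
Qed.

Lemma tree_on_contract (V : vert -> Prop) w x E :
  w <> x -> ~ V w -> tree_on V ((w, x) :: E) <-> tree_on V (map (sube w x) E).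
Proof.
  intros Hn HV; unfold tree_on; rewrite forest_contract.
  assert (forall u v, V u -> V v ->
    (conn ((w, x) :: E) u v <-> conn (map (sube w x) E) u v)).
  { intros u v Hu Hv; rewrite conn_contract, !subv_neq by congruence; tauto. }
  split; intros [H1 H2]; (split; [|tauto]); intros u v Hu Hv; apply H; auto.
Qed.

Definition avoid (W : list edge) (u : vert) : Prop :=
  forall e, In e W -> fst e <> u /\ snd e <> u.

Lemma avoid_app W W' u : avoid (W ++ W') u <-> avoid W u /\ avoid W' u.
Proof.
  unfold avoid; split.
  - intros H; split; intros e He; apply H, in_or_app; auto.
  - intros [H1 H2] e He; apply in_app_or in He as [He|He]; auto.
Qed.

Lemma avoid_cons a b W u : avoid ((a, b) :: W) u <-> (a <> u /\ b <> u) /\ avoid W u.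
Proof.
  unfold avoid; split.
  - intros H; split; [apply (H (a, b)); left; auto|intros e He; apply H; right; auto].
  - intros [H1 H2] e [<-|He]; auto.
Qed.

Lemma map_sube_same W x : map (sube x x) W = W.
Proof.
  rewrite <- (map_id W) at 2; apply map_ext; intros [a b]; unfold sube, subv; simpl.
  destruct (vert_eq_dec a x), (vert_eq_dec b x); congruence.
Qed.

Lemma map_sube_avoid W w x : avoid W w -> map (sube w x) W = W.
Proof.
  intros H; rewrite <- (map_id W) at 2; apply map_ext_in.
  intros [a b] He; apply H in He as [H1 H2]; unfold sube; simpl in *.
  rewrite !subv_neq; auto.
Qed.

(** * Acyclicity *)

Fixpoint walk (R : relation vert) (x : vert) (l : list vert) : Prop :=
  match l with
  | [] => True
  | y :: l' => R x y /\ walk R y l'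
  end.

Lemma walk_suffix R l1 : forall x y l2, walk R x (l1 ++ y :: l2) -> walk R y l2.
Proof. induction l1 as [|z l1 IH]; intros x y l2 [H1 H2]; eauto. Qed.

Lemma last_cons_default (l : list vert) : forall a d d', last (a :: l) d = last (a :: l) d'.
Proof. induction l as [|b l IH]; intros a d d'; [reflexivity|exact (IH b d d')]. Qed.

Lemma last_app_cons (l1 : list vert) y l2 d : last (l1 ++ y :: l2) d = last (y :: l2) d.
Proof.
  induction l1 as [|z l1 IH]; [reflexivity|].
  rewrite <- IH; simpl; destruct (l1 ++ y :: l2) eqn:Q; [destruct l1; discriminate|reflexivity].
Qed.

Lemma simple_walk R x y :
  clos_refl_trans vert R x y ->
  exists l, walk R x l /\ NoDup (x :: l) /\ last (x :: l) x = y.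
Proof.
  intros H; apply clos_rt_rt1n in H; induction H as [x|x z y Hs H (l & Hw & Hd & Hl)].
  - exists []; repeat split; constructor; auto; constructor.
  (* Loop erasure: if [x] already occurs on the walk, keep only the part after that occurrence. *)
  - destruct (in_dec vert_eq_dec x (z :: l)) as [Hi|Hi].
    + apply in_split in Hi as (l1 & l2 & Q).
      assert (Hw' : walk R x (z :: l)) by (split; auto).
      rewrite Q in Hw', Hd, Hl; exists l2; split; [eapply walk_suffix; eauto|split].
      * apply NoDup_app_remove_l in Hd; auto.
      * rewrite last_app_cons in Hl; rewrite <- Hl; apply last_cons_default.
    + exists (z :: l); split; [split; auto|split; [constructor; auto|]].
      rewrite <- Hl; apply (last_cons_default l z).
Qed.

Lemma walk_nth R d : forall l x n, walk R x l -> S n < length (x :: l) ->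
  R (nth n (x :: l) d) (nth (S n) (x :: l) d).
Proof.
  induction l as [|y l IH]; intros x n H Hn; simpl in Hn; [lia|].
  destruct H as [H1 H2], n as [|n]; [exact H1|apply (IH y n H2); simpl; lia].
Qed.

Lemma adj_minus_sym E x y a b : adj_minus E x y a b -> adj_minus E x y b a.
Proof. unfold adj_minus, adj; tauto. Qed.

Lemma acyclic_bridge E x y :
  acyclic E -> In (x, y) E -> x <> y ->
  ~ clos_refl_trans vert (adj_minus E x y) x y.
Proof.
  intros HA He Hn H; apply simple_walk in H as (l & Hw & Hd & Hl).
  apply (HA (x :: l)); split; [|split; [exact Hd|split]].
  (* The closed walk has at least three vertices, since a walk of one step would be the forbidden
     edge itself. *)
  - destruct l as [|z [|z' l]]; simpl in *; [congruence| |lia].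
    subst z; destruct Hw as [[_ Hw] _]; tauto.
  - intros n Hn'; apply (walk_nth _ (VLeaf 0)) with (n := n) in Hw; [apply Hw|exact Hn'].
  - rewrite (last_cons_default l x _ x), Hl; right; exact He.
Qed.

(** [is_cycle] needs three distinct vertices and is blind to loops and to edges repeated in either
    direction, so the first two hypotheses exclude those. *)
Lemma acyclic_forest E :
  NoDup E -> (forall u v, In (u, v) E -> u <> v /\ ~ In (v, u) E) ->
  acyclic E -> forest E.
Proof.
  induction E as [|[u v] E IH]; simpl; auto.
  intros Hd Ho HA; inversion Hd as [|? ? Hn Hd']; subst; split.
  - destruct (Ho u v (or_introl eq_refl)) as [Huv Hvu].
    intros C; apply (acyclic_bridge _ u v HA (or_introl eq_refl) Huv).
    revert C; apply conn_realize.
    + split; intros a.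
      * apply rt_refl.
      * intros b c; apply rt_trans.
      * intros b; apply clos_rt_sym; apply adj_minus_sym.
    + intros [a b] He; apply rt_step; split; [left; right; exact He|].
      simpl; intros [[-> ->]|[-> ->]]; tauto.
  - apply IH; auto.
    + intros a b Hab; destruct (Ho a b (or_intror Hab)); tauto.
    + intros c (H1 & H2 & H3 & H4); apply (HA c); unfold is_cycle, adj in *; simpl.
      repeat split; auto; [|tauto]. intros n Hn'; specialize (H3 n Hn'); tauto.
Qed.

Lemma nth_last (l : list vert) d : last l d = nth (length l - 1) l d.
Proof.
  induction l as [|a [|b l] IH]; auto.
  change (last (a :: b :: l) d) with (last (b :: l) d); rewrite IH; simpl.
  rewrite Nat.sub_0_r; reflexivity.
Qed.

Lemma forest_acyclic E : forest E -> acyclic E.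
Proof.
  intros HF c (Hlen & Hd & Hs & Hc). set (d := VLeaf 0) in *.
  assert (Hh : hd d c = nth 0 c d) by (destruct c; reflexivity).
  rewrite nth_last, Hh in Hc.
  assert (Hex : exists a b E', Permutation E ((a, b) :: E') /\
    ((a = nth (length c - 1) c d /\ b = nth 0 c d) \/
     (b = nth (length c - 1) c d /\ a = nth 0 c d))).
  { destruct Hc as [Hc|Hc]; apply in_split in Hc as (E1 & E2 & ->);
      do 2 eexists; exists (E1 ++ E2); (split; [apply Permutation_sym, Permutation_middle|]);
      auto. }
  destruct Hex as (a & b & E' & HP & Hab).
  assert (HB := forest_bridge _ _ _ _ HF HP).
  assert (P : forall n, n < length c -> conn E' (nth 0 c d) (nth n c d)).
  { induction n as [|n IH]; intros Hn; [apply rt_refl|].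
    eapply conn_trans; [apply IH; lia|].
    assert (NI : forall p q, p < length c -> q < length c -> nth p c d = nth q c d -> p = q)
      by (apply NoDup_nth, Hd).
    assert (Q : forall u v, In (u, v) E -> (u, v) <> (a, b) -> In (u, v) E').
    { intros u v H1 H2; apply (Permutation_in _ HP) in H1 as [H1|H1]; congruence. }
    (* Vertices of the cycle are distinct, so a pair of positions gives the closing edge only if
       these are the first and the last. Consecutive positions cannot be, as the length is at least
       3; all other edges of the cycle thus survive in [E']. *)
    assert (X : forall p q, p < length c -> q < length c -> (nth p c d, nth q c d) = (a, b) ->
       (p = length c - 1 /\ q = 0) \/ (q = length c - 1 /\ p = 0)).
    { intros p q Hp Hq EQ; injection EQ as E1 E2.
      destruct Hab as [[-> ->]|[-> ->]]; [left|right]; split; apply NI; auto; lia. }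
    destruct (Hs n Hn) as [H1|H1]; [apply conn_edge|apply conn_sym, conn_edge];
      apply Q; auto; intros EQ; apply X in EQ; lia. }
  specialize (P (length c - 1)); apply HB.
  destruct Hab as [[-> ->]|[-> ->]]; [apply conn_sym|]; apply P; lia.
Qed.

(** * A tactic for permutations of concatenations *)

Lemma perm_nil_r {A} (l m : list A) : Permutation (l ++ []) (m ++ []) -> Permutation l m.
Proof. rewrite !app_nil_r; auto. Qed.

Lemma perm_app_inv {A} (l r t t' : list A) :
  Permutation t (l ++ t') -> Permutation r t' -> Permutation (l ++ r) t.
Proof. intros H ->; symmetry; exact H. Qed.

Lemma perm_cons_inv {A} (x : A) r t t' :
  Permutation t (x :: t') -> Permutation r t' -> Permutation (x :: r) t.
Proof. intros H ->; symmetry; exact H. Qed.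

Lemma perm_skip_app {A} (l m t t' : list A) :
  Permutation t (l ++ t') -> Permutation (m ++ t) (l ++ m ++ t').
Proof. intros ->; apply Permutation_app_swap_app. Qed.

Lemma perm_skip_cons {A} (x : A) l t t' :
  Permutation t (l ++ t') -> Permutation (x :: t) (l ++ x :: t').
Proof. intros ->; apply Permutation_middle. Qed.

Lemma perm_cons_skip_app {A} (x : A) m t t' :
  Permutation t (x :: t') -> Permutation (m ++ t) (x :: m ++ t').
Proof. intros ->; symmetry; apply Permutation_middle. Qed.

Lemma perm_cons_skip_cons {A} (x y : A) t t' :
  Permutation t (x :: t') -> Permutation (y :: t) (x :: y :: t').
Proof. intros ->; apply perm_swap. Qed.

(** Finds one block or element anywhere in the left-hand list; the list without it instantiates the
    existential tail. [perm_loop] cancels the blocks of the goal in this way one after another. *)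
Ltac perm_find := first
  [ apply Permutation_refl
  | apply perm_skip_app; perm_find
  | apply perm_skip_cons; perm_find
  | apply perm_cons_skip_app; perm_find
  | apply perm_cons_skip_cons; perm_find ].
Ltac perm_loop := first
  [ apply perm_nil
  | eapply perm_app_inv; [perm_find|perm_loop]
  | eapply perm_cons_inv; [perm_find|perm_loop] ].
Ltac perm := apply perm_nil_r; repeat rewrite <- app_assoc; cbn [app];
  repeat rewrite <- app_assoc; cbn [app]; perm_loop.

(** * Collapsing a switched tree onto its leaves *)

Definition ids (t : tree) : list nat := map snd (leaves t).

Lemma ids_tens a b : ids (Tens a b) = ids a ++ ids b.
Proof. apply map_app. Qed.

Lemma ids_par a b : ids (Par a b) = ids a ++ ids b.
Proof. apply map_app. Qed.

(** [coll nd t r E]: in some switching of [t], contracting every internal node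
    onto the representative leaf of one of its children leaves the edges [E], with
    [r] standing for the root.  A tensor takes the representative of its left child;
    with [nd = true] it may also take that of its right child, so that every leaf of
    [t] represents the root in some collapse. *)
Inductive coll (nd : bool) : tree -> nat -> list edge -> Prop :=
| coll_leaf l i : coll nd (Lf l i) i []
| coll_tens_l a b r1 r2 E1 E2 :
    coll nd a r1 E1 -> coll nd b r2 E2 ->
    coll nd (Tens a b) r1 ((VLeaf r1, VLeaf r2) :: E1 ++ E2)
| coll_tens_r a b r1 r2 E1 E2 :
    nd = true -> coll nd a r1 E1 -> coll nd b r2 E2 ->
    coll nd (Tens a b) r2 ((VLeaf r2, VLeaf r1) :: E1 ++ E2)
| coll_par_l a b r1 r2 E1 E2 :
    coll nd a r1 E1 -> coll nd b r2 E2 -> coll nd (Par a b) r1 (E1 ++ E2)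
| coll_par_r a b r1 r2 E1 E2 :
    coll nd a r1 E1 -> coll nd b r2 E2 -> coll nd (Par a b) r2 (E1 ++ E2).

Lemma coll_true nd t r E : coll nd t r E -> coll true t r E.
Proof.
  induction 1; [apply coll_leaf|apply coll_tens_l|apply coll_tens_r|eapply coll_par_l|
    eapply coll_par_r]; eauto.
Qed.

Lemma coll_ids nd t r E : coll nd t r E ->
  In r (ids t) /\
  forall e, In e E -> exists i j, e = (VLeaf i, VLeaf j) /\ In i (ids t) /\ In j (ids t).
Proof.
  induction 1 as [l i|a b r1 r2 E1 E2 H1 [I1 J1] H2 [I2 J2]
    |a b r1 r2 E1 E2 _ H1 [I1 J1] H2 [I2 J2]
    |a b r1 r2 E1 E2 H1 [I1 J1] H2 [I2 J2]|a b r1 r2 E1 E2 H1 [I1 J1] H2 [I2 J2]];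
    [split; [left; auto|intros e []]|..];
    rewrite ?ids_tens, ?ids_par; (split; [apply in_or_app; auto|]);
    intros e He; simpl in He;
    repeat match goal with
    | H : _ \/ _ |- _ => destruct H
    | H : In _ (_ ++ _) |- _ => apply in_app_or in H
    end;
    try (apply J1 in H as (i & j & -> & Hi & Hj));
    try (apply J2 in H as (i & j & -> & Hi & Hj)); subst;
    do 2 eexists; (split; [reflexivity|]); split; apply in_or_app; auto.
Qed.

(** At each node above [x], take the child that contains [x]; at a tensor with [x] on the right this
    is the choice opened by [nd = true]. *)
Lemma coll_any_rep t x : In x (ids t) -> exists E, coll true t x E.
Proof.
  assert (T : forall t, exists r E, coll true t r E).
  { clear; induction t as [l i|a (r & E & H) b (r' & E' & H')|a (r & E & H) b (r' & E' & H')];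
      do 2 eexists; econstructor; eauto. }
  induction t as [l i|a IHa b IHb|a IHa b IHb].
  - intros [<-|[]]; eexists; constructor.
  - rewrite ids_tens; intros H; apply in_app_or in H as [H|H].
    + destruct (IHa H) as [E HE], (T b) as (r' & E' & HE'); eexists; econstructor; eauto.
    + destruct (IHb H) as [E HE], (T a) as (r' & E' & HE'); eexists; apply coll_tens_r; eauto.
  - rewrite ids_par; intros H; apply in_app_or in H as [H|H].
    + destruct (IHa H) as [E HE], (T b) as (r' & E' & HE'); eexists; econstructor; eauto.
    + destruct (IHb H) as [E HE], (T a) as (r' & E' & HE'); eexists; eapply coll_par_r; eauto.
Qed.

(** The same collapse tied to a given switching, which the edges of the graph read off at addresses
    and which [coll] forgets. *)
Inductive tcoll (nd : bool) (f : list bool -> vert) (sw : vert -> bool) :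
  list bool -> tree -> nat -> list edge -> Prop :=
| tc_leaf p l i : tcoll nd f sw p (Lf l i) i []
| tc_tens_l p a b r1 r2 E1 E2 :
    tcoll nd f sw (p ++ [false]) a r1 E1 -> tcoll nd f sw (p ++ [true]) b r2 E2 ->
    tcoll nd f sw p (Tens a b) r1 ((VLeaf r1, VLeaf r2) :: E1 ++ E2)
| tc_tens_r p a b r1 r2 E1 E2 : nd = true ->
    tcoll nd f sw (p ++ [false]) a r1 E1 -> tcoll nd f sw (p ++ [true]) b r2 E2 ->
    tcoll nd f sw p (Tens a b) r2 ((VLeaf r2, VLeaf r1) :: E1 ++ E2)
| tc_par_l p a b r1 r2 E1 E2 : sw (f p) = false ->
    tcoll nd f sw (p ++ [false]) a r1 E1 -> tcoll nd f sw (p ++ [true]) b r2 E2 ->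
    tcoll nd f sw p (Par a b) r1 (E1 ++ E2)
| tc_par_r p a b r1 r2 E1 E2 : sw (f p) = true ->
    tcoll nd f sw (p ++ [false]) a r1 E1 -> tcoll nd f sw (p ++ [true]) b r2 E2 ->
    tcoll nd f sw p (Par a b) r2 (E1 ++ E2).

Lemma tcoll_coll nd f sw p t r E : tcoll nd f sw p t r E -> coll nd t r E.
Proof.
  induction 1; [apply coll_leaf|apply coll_tens_l|apply coll_tens_r|eapply coll_par_l|
    eapply coll_par_r]; eauto.
Qed.

Lemma tcoll_exists f sw t : forall p, exists r E, tcoll false f sw p t r E.
Proof.
  induction t as [l i|a IHa b IHb|a IHa b IHb]; intros p;
    [do 2 eexists; constructor|..];
    destruct (IHa (p ++ [false])) as (r & E & H), (IHb (p ++ [true])) as (r' & E' & H').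
  - do 2 eexists; eapply tc_tens_l; eauto.
  - destruct (sw (f p)) eqn:S; do 2 eexists; [eapply tc_par_r|eapply tc_par_l]; eauto.
Qed.

(** The switching [s] is indexed by addresses relative to the root of [t]. Switchings of the
    children can therefore be glued ([M]), and the result applies at any place [p] and under any
    naming [f]. *)
Lemma coll_switching nd t r E : coll nd t r E ->
  exists s : list bool -> bool, forall f (sw : vert -> bool) p,
    (forall q, sw (f (p ++ q)) = s q) -> tcoll nd f sw p t r E.
Proof.
  assert (M : forall b (s1 s2 : list bool -> bool), exists s, forall (f : list bool -> vert) (sw : vert -> bool) p,
    (forall q, sw (f (p ++ q)) = s q) -> sw (f p) = b /\
    (forall q, sw (f ((p ++ [false]) ++ q)) = s1 q) /\
    (forall q, sw (f ((p ++ [true]) ++ q)) = s2 q)).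
  { intros b s1 s2.
    exists (fun q => match q with [] => b | false :: q' => s1 q' | true :: q' => s2 q' end).
    intros f sw p H; split; [rewrite <- (app_nil_r p); apply H|].
    split; intros q; rewrite <- app_assoc; apply H. }
  induction 1 as [l i|a b r1 r2 E1 E2 _ [s1 H1] _ [s2 H2]|a b r1 r2 E1 E2 Hn _ [s1 H1] _ [s2 H2]
    |a b r1 r2 E1 E2 _ [s1 H1] _ [s2 H2]|a b r1 r2 E1 E2 _ [s1 H1] _ [s2 H2]].
  - exists (fun _ => true); intros; constructor.
  - destruct (M true s1 s2) as [s Hs]; exists s; intros f sw p H; apply Hs in H as (H & H3 & H4).
    apply tc_tens_l; auto.
  - destruct (M true s1 s2) as [s Hs]; exists s; intros f sw p H; apply Hs in H as (H & H3 & H4).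
    apply tc_tens_r; auto.
  - destruct (M false s1 s2) as [s Hs]; exists s; intros f sw p H; apply Hs in H as (H & H3 & H4).
    eapply tc_par_l; eauto.
  - destruct (M true s1 s2) as [s Hs]; exists s; intros f sw p H; apply Hs in H as (H & H3 & H4).
    eapply tc_par_r; eauto.
Qed.

Definition addressing (f : list bool -> vert) : Prop :=
  (forall p q, f p = f q -> p = q) /\ (forall p i, f p <> VLeaf i).

Lemma addressing_VP : addressing VP.
Proof. split; congruence. Qed.

Lemma addressing_VG k : addressing (VG k).
Proof. split; congruence. Qed.

Lemma rootv_cases f p t :
  (exists l i, t = Lf l i /\ rootv f p t = VLeaf i) \/ rootv f p t = f p.
Proof. destruct t; simpl; eauto. Qed.

Lemma tedges_verts f sw t : forall p e, In e (tedges f sw p t) ->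
  (exists q, fst e = f (p ++ q)) /\
  ((exists i, snd e = VLeaf i) \/ exists q, q <> [] /\ snd e = f (p ++ q)).
Proof.
  assert (R : forall p b t, (exists i, rootv f (p ++ [b]) t = VLeaf i) \/
    exists q, q <> [] /\ rootv f (p ++ [b]) t = f (p ++ q)).
  { intros p b t'; destruct (rootv_cases f (p ++ [b]) t') as [(l & i & _ & ->)| ->];
      [left; eauto|right; exists [b]; split; [discriminate|auto]]. }
  assert (S : forall p b (e : edge), ((exists q, fst e = f ((p ++ [b]) ++ q)) /\
  ((exists i, snd e = VLeaf i) \/ exists q, q <> [] /\ snd e = f ((p ++ [b]) ++ q))) ->
   ((exists q, fst e = f (p ++ q)) /\
  ((exists i, snd e = VLeaf i) \/ exists q, q <> [] /\ snd e = f (p ++ q)))).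
  { intros p b e ((q & Hq) & H); rewrite <- app_assoc in Hq; split; [eauto|].
    destruct H as [H|(q' & Hq' & H)]; auto; rewrite <- app_assoc in H.
    right; exists ([b] ++ q'); split; [discriminate|auto]. }
  assert (Z : forall p, exists q, f p = f (p ++ q)) by (exists []; rewrite app_nil_r; auto).
  induction t as [l i|a IHa b IHb|a IHa b IHb]; intros p e.
  - intros [].
  - intros [<-|[<-|He]]; simpl; auto.
    apply in_app_or in He as [He|He]; eapply S; eauto.
  - intros [<-|He]; simpl; [destruct (sw (f p)); simpl; auto|].
    apply in_app_or in He as [He|He]; eapply S; eauto.
Qed.

Section Collapse.
Variables (f : list bool -> vert) (sw : vert -> bool).
Hypothesis Hf : addressing f.

Lemma address_neq p q q' : q <> q' -> f (p ++ q) <> f (p ++ q').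
Proof. intros H H'; apply Hf, app_inv_head in H'; auto. Qed.

Lemma rootv_neq p b t q : q <> [b] -> rootv f (p ++ [b]) t <> f (p ++ q).
Proof.
  destruct (rootv_cases f (p ++ [b]) t) as [(l & i & _ & ->)| ->]; intros H H'.
  - symmetry in H'; revert H'; apply Hf.
  - revert H'; apply address_neq; auto.
Qed.

Lemma avoid_tedges p b t q :
  (forall q', q <> b :: q') -> avoid (tedges f sw (p ++ [b]) t) (f (p ++ q)).
Proof.
  intros Hq e He; apply tedges_verts in He as [[q1 ->] H].
  rewrite <- app_assoc; split; [apply address_neq; intros E; apply (Hq q1); auto|].
  destruct H as [[i ->]|[q2 [_ ->]]].
  - intros E; symmetry in E; revert E; apply Hf.
  - rewrite <- app_assoc; apply address_neq; intros E; apply (Hq q2); auto.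
Qed.

Lemma avoid_coll nd t r E q : coll nd t r E -> avoid E (f q).
Proof.
  intros H e He; apply coll_ids in H as [_ H]; apply H in He as (i & j & -> & _ & _).
  simpl; split; intros Q; symmetry in Q; revert Q; apply Hf.
Qed.

Lemma sub_root nd p t r E W : tcoll nd f sw p t r E -> avoid W (f p) ->
  map (sube (rootv f p t) (VLeaf r)) W = W.
Proof.
  intros H HW; destruct (rootv_cases f p t) as [(l & i & -> & ->)| ->];
    [|apply map_sube_avoid, HW].
  inversion H; subst; apply map_sube_same.
Qed.

Variable V : vert -> Prop.
Hypothesis HV : forall p, ~ V (f p).

Lemma tree_on_contract_root p (i : nat) E W : avoid E (f p) ->
  tree_on V ((f p, VLeaf i) :: E ++ W) <->
  tree_on V (E ++ map (sube (f p) (VLeaf i)) W).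
Proof.
  intros H; rewrite tree_on_contract, map_app, (map_sube_avoid _ _ _ H);
    [tauto|apply Hf|apply HV].
Qed.

(** The root [f p] itself may occur in [W]: its edge to the parent belongs to the surroundings and
    is redirected by the contraction. *)
Definition fresh_below (p : list bool) (W : list edge) : Prop :=
  forall q, q <> [] -> avoid W (f (p ++ q)).

Definition fresh_child (p : list bool) (b : bool) (W : list edge) : Prop :=
  forall q, avoid W (f (p ++ b :: q)).

Lemma fresh_child_below p b W : fresh_below p W -> fresh_child p b W.
Proof. intros H q; apply H; discriminate. Qed.

Lemma fresh_child_below_child p b W : fresh_child p b W -> fresh_below (p ++ [b]) W.
Proof. intros H q _; rewrite <- app_assoc; apply H. Qed.

Lemma fresh_child_app p b W W' :
  fresh_child p b W -> fresh_child p b W' -> fresh_child p b (W ++ W').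
Proof. intros H H' q; apply avoid_app; auto. Qed.

Lemma fresh_child_tedges p b b' t : b' <> b -> fresh_child p b (tedges f sw (p ++ [b']) t).
Proof. intros H q; apply avoid_tedges; congruence. Qed.

Lemma fresh_child_coll nd p b t r E : coll nd t r E -> fresh_child p b E.
Proof. intros H q; eapply avoid_coll; eauto. Qed.

Lemma parent_neq p b q : f p <> f (p ++ b :: q).
Proof. rewrite <- (app_nil_r p) at 1; apply address_neq; discriminate. Qed.

Lemma fresh_child_sibling p b b' t W : b' <> b -> fresh_child p b W ->
  fresh_child p b ((f p, rootv f (p ++ [b']) t) :: W).
Proof.
  intros H H' q; apply avoid_cons; split; [split; [apply parent_neq|]|apply H'].
  apply rootv_neq; congruence.
Qed.

Lemma fresh_child_leaf p b i W : fresh_child p b W -> fresh_child p b ((f p, VLeaf i) :: W).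
Proof.
  intros H q; apply avoid_cons; split; [split; [apply parent_neq|]|apply H].
  intros Q; symmetry in Q; revert Q; apply Hf.
Qed.

(** The surroundings [W] are arbitrary, so that while one child is collapsed the edges of its
    sibling and of its parent can be kept in [W]. *)
Definition collapses nd p t : Prop := forall r E W,
  tcoll nd f sw p t r E -> fresh_below p W ->
  tree_on V (tedges f sw p t ++ W) <->
  tree_on V (E ++ map (sube (rootv f p t) (VLeaf r)) W).

Lemma collapse_detached_child nd p b t r E W :
  collapses nd (p ++ [b]) t -> tcoll nd f sw (p ++ [b]) t r E -> fresh_child p b W ->
  tree_on V (tedges f sw (p ++ [b]) t ++ W) <-> tree_on V (E ++ W).
Proof.
  intros H HT HW; rewrite (H r E W HT) by apply fresh_child_below_child, HW.
  rewrite (sub_root nd _ t r E W HT) by apply HW; tauto.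
Qed.

Lemma collapse_attached_child nd p b t r E W :
  collapses nd (p ++ [b]) t -> tcoll nd f sw (p ++ [b]) t r E -> fresh_child p b W ->
  tree_on V (tedges f sw (p ++ [b]) t ++ (f p, rootv f (p ++ [b]) t) :: W) <->
  tree_on V (E ++ (f p, VLeaf r) :: W).
Proof.
  intros H HT HW; rewrite (H r E _ HT).
  - simpl map; rewrite (sub_root nd _ t r E W HT) by apply HW.
    unfold sube; simpl; rewrite subv_eq, subv_neq; [tauto|].
    apply not_eq_sym; rewrite <- (app_nil_r p) at 2; apply rootv_neq; discriminate.
  - intros q Hq; apply avoid_cons; split; [|apply fresh_child_below_child; auto].
    rewrite <- app_assoc; split; [apply parent_neq|].
    apply rootv_neq; simpl; congruence.
Qed.

Ltac prove_fresh := repeat first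
  [ apply fresh_child_app
  | apply fresh_child_tedges; discriminate
  | eapply fresh_child_coll, tcoll_coll; eassumption
  | apply fresh_child_sibling; [discriminate|]
  | apply fresh_child_leaf
  | apply fresh_child_below; assumption ].

Ltac permute L := rewrite (tree_on_perm V _ L) by perm.

(** Collapse the children first; the node then has an edge to the representative of each child still
    attached, and one of these edges is contracted. *)
Lemma tree_on_collapse nd t : forall p, collapses nd p t.
Proof.
  induction t as [l i|a IHa b IHb|a IHa b IHb]; intros p r E W HT HW.
  - inversion HT; subst; simpl; rewrite map_sube_same; tauto.
  (* Both tensor cases share this stage; they differ only in which of the two edges at [f p] is
     contracted, and the other one becomes the edge between representatives. *)
  - assert (C : forall r1 r2 E1 E2, tcoll nd f sw (p ++ [false]) a r1 E1 ->
      tcoll nd f sw (p ++ [true]) b r2 E2 ->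
      tree_on V (tedges f sw p (Tens a b) ++ W) <->
      tree_on V ((f p, VLeaf r1) :: (f p, VLeaf r2) :: E1 ++ E2 ++ W)).
    { intros r1 r2 E1 E2 H1 H2; simpl.
      permute (tedges f sw (p ++ [false]) a ++ (f p, rootv f (p ++ [false]) a)
        :: (f p, rootv f (p ++ [true]) b) :: tedges f sw (p ++ [true]) b ++ W).
      rewrite (collapse_attached_child nd p false a r1 E1) by (auto; prove_fresh).
      permute (tedges f sw (p ++ [true]) b ++ (f p, rootv f (p ++ [true]) b)
        :: (f p, VLeaf r1) :: E1 ++ W).
      rewrite (collapse_attached_child nd p true b r2 E2) by (auto; prove_fresh).
      permute ((f p, VLeaf r1) :: (f p, VLeaf r2) :: E1 ++ E2 ++ W); tauto. }
    inversion HT as [|? ? ? r1 r2 E1 E2 H1 H2|? ? ? r1 r2 E1 E2 _ H1 H2| |]; subst;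
      rewrite (C _ _ _ _ H1 H2);
      assert (A1 := avoid_coll _ _ _ _ p (tcoll_coll _ _ _ _ _ _ _ H1));
      assert (A2 := avoid_coll _ _ _ _ p (tcoll_coll _ _ _ _ _ _ _ H2)).
    + permute ((f p, VLeaf r) :: (E1 ++ E2) ++ (f p, VLeaf r2) :: W).
      rewrite tree_on_contract_root by (apply avoid_app; auto).
      simpl map; unfold sube at 1; simpl; rewrite subv_eq, subv_neq
        by (intros Q; symmetry in Q; revert Q; apply Hf).
      permute ((VLeaf r, VLeaf r2) :: (E1 ++ E2) ++ map (sube (f p) (VLeaf r)) W); tauto.
    + permute ((f p, VLeaf r) :: (E1 ++ E2) ++ (f p, VLeaf r1) :: W).
      rewrite tree_on_contract_root by (apply avoid_app; auto).
      simpl map; unfold sube at 1; simpl; rewrite subv_eq, subv_neq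
        by (intros Q; symmetry in Q; revert Q; apply Hf).
      permute ((VLeaf r, VLeaf r1) :: (E1 ++ E2) ++ map (sube (f p) (VLeaf r)) W); tauto.
  - inversion HT as [| | |? ? ? r1 r2 E1 E2 Hs H1 H2|? ? ? r1 r2 E1 E2 Hs H1 H2]; subst;
      simpl; rewrite Hs;
      assert (A1 := avoid_coll _ _ _ _ p (tcoll_coll _ _ _ _ _ _ _ H1));
      assert (A2 := avoid_coll _ _ _ _ p (tcoll_coll _ _ _ _ _ _ _ H2)).
    + permute (tedges f sw (p ++ [false]) a ++ (f p, rootv f (p ++ [false]) a)
        :: tedges f sw (p ++ [true]) b ++ W).
      rewrite (collapse_attached_child nd p false a r E1) by (auto; prove_fresh).
      permute (tedges f sw (p ++ [true]) b ++ (f p, VLeaf r) :: E1 ++ W).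
      rewrite (collapse_detached_child nd p true b r2 E2) by (auto; prove_fresh).
      permute ((f p, VLeaf r) :: (E1 ++ E2) ++ W).
      apply tree_on_contract_root, avoid_app; auto.
    + permute (tedges f sw (p ++ [false]) a ++ (f p, rootv f (p ++ [true]) b)
        :: tedges f sw (p ++ [true]) b ++ W).
      rewrite (collapse_detached_child nd p false a r1 E1) by (auto; prove_fresh).
      permute (tedges f sw (p ++ [true]) b ++ (f p, rootv f (p ++ [true]) b) :: E1 ++ W).
      rewrite (collapse_attached_child nd p true b r E2) by (auto; prove_fresh).
      permute ((f p, VLeaf r) :: (E1 ++ E2) ++ W).
      apply tree_on_contract_root, avoid_app; auto.
Qed.
End Collapse.

(** * Proof graphs in terms of collapses *)

(** In a switching a cut behaves like a tensor, down to the addresses of its nodes, so one theory of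
    trees serves both parts of the graph. *)
Definition itree (it : item) : tree :=
  match it with Form A => A | Cut A B => Tens A B end.

Lemma iedges_itree sw k it : iedges sw k it = tedges (VG k) sw [] (itree it).
Proof. destruct it; reflexivity. Qed.

Lemma iverts_itree k it : iverts k it = tverts (VG k) [] (itree it).
Proof. destruct it; reflexivity. Qed.

Lemma item_leaves_itree it : item_leaves it = leaves (itree it).
Proof. destruct it; reflexivity. Qed.

(** All representatives are allowed here: rewriting leaves the sequent alone, so the same [EG]
    serves before and after a step. *)
Inductive seq_coll : list item -> list edge -> Prop :=
| seq_coll_nil : seq_coll [] []
| seq_coll_cons it G r E EG :
    coll true (itree it) r E -> seq_coll G EG -> seq_coll (it :: G) (E ++ EG).

Inductive seq_tcoll (sw : vert -> bool) : nat -> list item -> list edge -> Prop :=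
| seq_tcoll_nil k : seq_tcoll sw k [] []
| seq_tcoll_cons k it G r E EG :
    tcoll true (VG k) sw [] (itree it) r E -> seq_tcoll sw (S k) G EG ->
    seq_tcoll sw k (it :: G) (E ++ EG).

Lemma seq_coll_switching G EG : seq_coll G EG ->
  exists s : nat -> list bool -> bool, forall sw k,
    (forall n q, sw (VG (k + n) q) = s n q) -> seq_tcoll sw k G EG.
Proof.
  induction 1 as [|it G r E EG H _ [s2 IH]].
  - exists (fun _ _ => true); constructor.
  - destruct (coll_switching _ _ _ _ H) as [s1 H1].
    exists (fun n => match n with O => s1 | S m => s2 m end); intros sw k Hk.
    econstructor.
    + apply H1; intros q; rewrite <- (Hk 0), Nat.add_0_r; reflexivity.
    + apply IH; intros n q; rewrite <- (Hk (S n)), Nat.add_succ_r; reflexivity.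
Qed.

Lemma tcoll_true nd f sw p t r E : tcoll nd f sw p t r E -> tcoll true f sw p t r E.
Proof.
  induction 1; [apply tc_leaf|apply tc_tens_l|apply tc_tens_r|eapply tc_par_l|
    eapply tc_par_r]; eauto.
Qed.

Lemma seq_tcoll_exists sw G : forall k, exists EG, seq_tcoll sw k G EG.
Proof.
  induction G as [|it G IH]; intros k; [eexists; constructor|].
  destruct (IH (S k)) as [EG HG], (tcoll_exists (VG k) sw (itree it) []) as (r & E & H).
  eexists; econstructor; eauto using tcoll_true.
Qed.

Lemma seq_tcoll_coll sw k G EG : seq_tcoll sw k G EG -> seq_coll G EG.
Proof. induction 1; econstructor; eauto using tcoll_coll. Qed.

Lemma tedges_lengths f sw t p e : In e (tedges f sw p t) ->
  exists q, fst e = f q /\ ((exists i, snd e = VLeaf i) \/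
    exists q', length q < length q' /\ snd e = f q').
Proof.
  assert (R : forall p b t, (exists i, rootv f (p ++ [b]) t = VLeaf i) \/
    exists q, length p < length q /\ rootv f (p ++ [b]) t = f q).
  { intros p' b t'; destruct (rootv_cases f (p' ++ [b]) t') as [(l & i & _ & ->)| ->];
      [left; eauto|right; exists (p' ++ [b]); rewrite length_app; simpl; split; [lia|auto]]. }
  revert p; induction t as [l i|a IHa b IHb|a IHa b IHb]; intros p.
  - intros [].
  - intros [<-|[<-|He]]; simpl; eauto.
    apply in_app_or in He as [He|He]; eauto.
  - intros [<-|He]; simpl; [destruct (sw (f p)); simpl; eauto|].
    apply in_app_or in He as [He|He]; eauto.
Qed.

Lemma sedges_verts sw G : forall k e, In e (sedges sw k G) ->
  exists k' q, k <= k' /\ fst e = VG k' q /\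
   ((exists i, snd e = VLeaf i) \/ exists q', length q < length q' /\ snd e = VG k' q').
Proof.
  induction G as [|it G IH]; simpl; intros k e He; [contradiction|].
  apply in_app_or in He as [He|He].
  - rewrite iedges_itree in He; apply tedges_lengths in He as (q & Hq & H).
    exists k, q; split; [lia|auto].
  - apply IH in He as (k' & q & Hk & H); exists k', q; split; [lia|exact H].
Qed.

Lemma tree_on_seq_collapse (V : vert -> Prop) sw G :
  (forall k p, ~ V (VG k p)) -> forall k EG, seq_tcoll sw k G EG ->
  forall W, (forall k' q, k <= k' -> avoid W (VG k' q)) ->
  tree_on V (sedges sw k G ++ W) <-> tree_on V (EG ++ W).
Proof.
  intros HV; induction G as [|it G IH]; intros k EG H W HW;
    inversion H as [|? ? ? r E EG' H1 H2]; subst; [tauto|]; simpl.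
  assert (HE : forall k' q, avoid E (VG k' q)).
  { intros k' q; apply (avoid_coll (VG k') (addressing_VG k') true (itree it) r).
    eapply tcoll_coll; eauto. }
  rewrite iedges_itree, <- app_assoc.
  assert (HS : forall q, avoid (sedges sw (S k) G) (VG k q)).
  { intros q e He; apply sedges_verts in He as (k' & q1 & Hk & -> & H').
    split; [intros Q; injection Q; lia|].
    destruct H' as [[i ->]|(q' & _ & ->)]; [congruence|intros Q; injection Q; lia]. }
  rewrite (tree_on_collapse (VG k) sw (addressing_VG k) V (HV k) true _ [] r E _ H1)
    by (intros q _; apply avoid_app; auto).
  rewrite (sub_root (VG k) sw true [] _ r E _ H1) by (apply avoid_app; auto).
  rewrite <- app_assoc, (tree_on_perm V _ (sedges sw (S k) G ++ (E ++ W))) by perm.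
  rewrite (IH (S k) EG' H2); [apply tree_on_perm; perm|].
  intros k' q Hk; apply avoid_app; split; [apply HE|apply HW; lia].
Qed.

Definition leafset (G : list item) (u : vert) : Prop :=
  exists i, u = VLeaf i /\ In i (map snd (seq_leaves G)).

Definition all_trees (nd : bool) (P : tree) (G : list item) : Prop :=
  forall r E EG, coll nd P r E -> seq_coll G EG -> tree_on (leafset G) (E ++ EG).

Lemma tree_on_pg_edges nd sw P G r E EG :
  tcoll nd VP sw [] P r E -> seq_tcoll sw 0 G EG ->
  tree_on (leafset G) (pg_edges sw P G) <-> tree_on (leafset G) (E ++ EG).
Proof.
  intros HP HG; unfold pg_edges.
  assert (HS : forall q, avoid (sedges sw 0 G) (VP q)).
  { intros q e He; apply sedges_verts in He as (k' & q1 & Hk & -> & H').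
    split; [congruence|]. destruct H' as [[i ->]|(q' & _ & ->)]; congruence. }
  assert (HV : forall q, ~ leafset G (VP q)) by (intros q (i & Q & _); discriminate).
  rewrite (tree_on_collapse VP sw addressing_VP (leafset G) HV nd P [] r E _ HP)
    by (intros q _; apply HS).
  rewrite (sub_root VP sw nd [] _ r E _ HP) by apply HS.
  rewrite (tree_on_perm _ _ (sedges sw 0 G ++ E)) by perm.
  rewrite (tree_on_seq_collapse (leafset G) sw G) with (EG := EG); auto.
  - apply tree_on_perm; perm.
  - intros k p (i & Q & _); discriminate.
  - intros k' q _; apply (avoid_coll (VG k') (addressing_VG k') nd P r).
    eapply tcoll_coll; eauto.
Qed.

(** Every switching keeps at least one edge downwards at each internal node, so descending reaches a
    leaf. Connectivity of the leaves thus extends to all vertices. *)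
Lemma tverts_conn f sw t : forall p v, In v (tverts f p t) ->
  exists i, In i (ids t) /\ conn (tedges f sw p t) v (VLeaf i).
Proof.
  assert (R : forall t p, In (rootv f p t) (tverts f p t)) by (intros []; simpl; auto).
  assert (I : forall t E p v, incl (tedges f sw p t) E ->
    (exists i, In i (ids t) /\ conn (tedges f sw p t) v (VLeaf i)) ->
    exists i, In i (ids t) /\ conn E v (VLeaf i)).
  { intros t0 E p v Hi (i & Hi' & H); exists i; split; auto; eapply conn_incl; eauto. }
  induction t as [l i|a IHa b IHb|a IHa b IHb]; intros p v.
  - intros [<-|[]]; exists i; split; [left; auto|apply rt_refl].
  - set (E := tedges f sw p (Tens a b)).
    assert (Ia : incl (tedges f sw (p ++ [false]) a) E)
      by (intros e He; do 2 right; apply in_or_app; auto).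
    assert (Ib : incl (tedges f sw (p ++ [true]) b) E)
      by (intros e He; do 2 right; apply in_or_app; auto).
    rewrite ids_tens; intros [<-|Hv]; [|apply in_app_or in Hv as [Hv|Hv]].
    + destruct (I a E _ _ Ia (IHa _ _ (R a (p ++ [false])))) as (i & Hi & H).
      exists i; split; [apply in_or_app; auto|].
      eapply conn_trans; [apply conn_edge; left; reflexivity|exact H].
    + destruct (I a E _ _ Ia (IHa _ _ Hv)) as (i & Hi & H); exists i; split; auto.
      apply in_or_app; auto.
    + destruct (I b E _ _ Ib (IHb _ _ Hv)) as (i & Hi & H); exists i; split; auto.
      apply in_or_app; auto.
  - set (E := tedges f sw p (Par a b)).
    assert (Ia : incl (tedges f sw (p ++ [false]) a) E)
      by (intros e He; right; apply in_or_app; auto).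
    assert (Ib : incl (tedges f sw (p ++ [true]) b) E)
      by (intros e He; right; apply in_or_app; auto).
    rewrite ids_par; intros [<-|Hv]; [|apply in_app_or in Hv as [Hv|Hv]].
    + destruct (sw (f p)) eqn:S.
      * destruct (I b E _ _ Ib (IHb _ _ (R b (p ++ [true])))) as (i & Hi & H).
        exists i; split; [apply in_or_app; auto|].
        eapply conn_trans; [|exact H]; apply conn_edge; unfold E; simpl; rewrite S; left; auto.
      * destruct (I a E _ _ Ia (IHa _ _ (R a (p ++ [false])))) as (i & Hi & H).
        exists i; split; [apply in_or_app; auto|].
        eapply conn_trans; [|exact H]; apply conn_edge; unfold E; simpl; rewrite S; left; auto.
    + destruct (I a E _ _ Ia (IHa _ _ Hv)) as (i & Hi & H); exists i; split; auto.
      apply in_or_app; auto.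
    + destruct (I b E _ _ Ib (IHb _ _ Hv)) as (i & Hi & H); exists i; split; auto.
      apply in_or_app; auto.
Qed.

Lemma sverts_conn sw G : forall k v, In v (sverts k G) ->
  exists i, In i (map snd (seq_leaves G)) /\ conn (sedges sw k G) v (VLeaf i).
Proof.
  induction G as [|it G IH]; simpl; intros k v Hv; [contradiction|].
  rewrite map_app; apply in_app_or in Hv as [Hv|Hv].
  - rewrite iverts_itree in Hv; apply (tverts_conn _ sw) in Hv as (i & Hi & H).
    exists i; split; [apply in_or_app; left; rewrite item_leaves_itree; exact Hi|].
    rewrite iedges_itree; revert H; apply conn_incl, incl_appl, incl_refl.
  - destruct (IH _ _ Hv) as (i & Hi & H); exists i; split; [apply in_or_app; auto|].
    revert H; apply conn_incl, incl_appr, incl_refl.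
Qed.

Lemma ids_tverts f t : forall p i, In i (ids t) -> In (VLeaf i) (tverts f p t).
Proof.
  induction t as [l j|a IHa b IHb|a IHa b IHb]; intros p i.
  - intros [<-|[]]; left; auto.
  - rewrite ids_tens; intros H; right; apply in_or_app; apply in_app_or in H as [H|H]; auto.
  - rewrite ids_par; intros H; right; apply in_or_app; apply in_app_or in H as [H|H]; auto.
Qed.

(** Edges go from parent to child, hence to a longer address or to a leaf. Asymmetry of this order
    rules out loops and pairs of opposite edges. *)
Definition above (u v : vert) : Prop :=
  match u, v with
  | VLeaf _, _ => False
  | _, VLeaf _ => True
  | VP p, VP q => length p < length q
  | VG _ p, VG _ q => length p < length q
  | _, _ => False
  end.

Lemma above_asym u v : above u v -> ~ above v u.
Proof. destruct u, v; simpl; tauto || lia. Qed.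

Lemma tedges_targets f sw t : forall p v,
  In v (rootv f p t :: map snd (tedges f sw p t)) ->
  (exists i, In i (ids t) /\ v = VLeaf i) \/ exists q, v = f (p ++ q).
Proof.
  assert (S : forall p b t t', incl (ids t) (ids t') -> forall v,
    (exists i, In i (ids t) /\ v = VLeaf i) \/ (exists q, v = f ((p ++ [b]) ++ q)) ->
    (exists i, In i (ids t') /\ v = VLeaf i) \/ (exists q, v = f (p ++ q))).
  { intros p b t1 t2 Hi v [(i & H & ->)|(q & ->)]; [left; eauto|right].
    exists (b :: q); rewrite <- app_assoc; auto. }
  assert (Z : forall p, exists q, f p = f (p ++ q)) by (exists []; rewrite app_nil_r; auto).
  induction t as [l i|a IHa b IHb|a IHa b IHb]; intros p v.
  - intros [<-|[]]; left; exists i; split; [left|]; auto.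
  - assert (Sa := S p false a (Tens a b)); assert (Sb := S p true b (Tens a b)).
    rewrite ids_tens in *; specialize (Sa (incl_appl _ (incl_refl _)) v);
      specialize (Sb (incl_appr _ (incl_refl _)) v).
    simpl; rewrite map_app; intros [<-|[<-|[<-|H]]]; [right; apply Z|..].
    + apply Sa, IHa; left; auto.
    + apply Sb, IHb; left; auto.
    + apply in_app_or in H as [H|H]; [apply Sa, IHa; right; auto|apply Sb, IHb; right; auto].
  - assert (Sa := S p false a (Par a b)); assert (Sb := S p true b (Par a b)).
    rewrite ids_par in *; specialize (Sa (incl_appl _ (incl_refl _)) v);
      specialize (Sb (incl_appr _ (incl_refl _)) v).
    simpl; rewrite map_app; intros [<-|[H|H]]; [right; apply Z|..].
    + destruct (sw (f p)); subst v; [apply Sb, IHb|apply Sa, IHa]; left; auto.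
    + apply in_app_or in H as [H|H]; [apply Sa, IHa; right; auto|apply Sb, IHb; right; auto].
Qed.

Lemma NoDup_app_l {A} (l m : list A) : NoDup (l ++ m) -> NoDup l.
Proof.
  induction l as [|x l IH]; intros H; [constructor|inversion H; subst; constructor; auto].
  intros Hx; apply H2, in_or_app; auto.
Qed.

Lemma NoDup_app_disjoint {A} (l m : list A) x : NoDup (l ++ m) -> In x l -> ~ In x m.
Proof.
  induction l as [|y l IH]; intros H Hx; [contradiction|].
  inversion H as [|? ? H1 H2]; subst; destruct Hx as [->|Hx]; auto.
  intros Hm; apply H1, in_or_app; auto.
Qed.

(** In a tree an edge is determined by its target. The root is listed too because it becomes a
    target one level up. *)
Lemma NoDup_tedges_targets f sw t : addressing f -> NoDup (ids t) ->
  forall p, NoDup (rootv f p t :: map snd (tedges f sw p t)).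
Proof.
  intros Hf; induction t as [l i|a IHa b IHb|a IHa b IHb]; intros Hd p;
    [repeat constructor; auto| |]; rewrite ?ids_tens, ?ids_par in Hd.
  all: assert (Ha := IHa (NoDup_app_l _ _ Hd) (p ++ [false]));
    assert (Hb := IHb (NoDup_app_remove_l _ _ Hd) (p ++ [true]));
    assert (HN : NoDup (f p ::
      (rootv f (p ++ [false]) a :: map snd (tedges f sw (p ++ [false]) a)) ++
      (rootv f (p ++ [true]) b :: map snd (tedges f sw (p ++ [true]) b)))).
  1,3: constructor; [|apply NoDup_app; auto].
  1,3: intros H; apply in_app_or in H as [H|H];
      apply tedges_targets in H as [(i & _ & Q)|(q & Q)];
      [apply Hf in Q; auto|rewrite <- app_assoc in Q; revert Q; apply (parent_neq f Hf)
      |apply Hf in Q; auto|rewrite <- app_assoc in Q; revert Q; apply (parent_neq f Hf)].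
  1,2: intros v Hv Hv'; apply tedges_targets in Hv, Hv';
      destruct Hv as [(i & Hi & ->)|(q & ->)], Hv' as [(j & Hj & Q)|(q' & Q)];
      [injection Q as ->; exact (NoDup_app_disjoint _ _ _ Hd Hi Hj)
      |symmetry in Q; revert Q; apply Hf|revert Q; apply Hf
      |rewrite <- !app_assoc in Q; revert Q; apply (address_neq f Hf); discriminate].
  all: inversion HN as [|? ? H1 H2]; subst; constructor; simpl.
  - intros H; apply H1; rewrite map_app in H; simpl; rewrite in_app_iff in *; simpl; tauto.
  - eapply Permutation_NoDup; [|exact H2]; rewrite map_app; perm.
  - intros H; apply H1; rewrite map_app in H; destruct (sw (f p)); simpl in H;
      simpl; rewrite in_app_iff in *; simpl; tauto.
  - rewrite map_app; destruct (sw (f p)); simpl.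
    + apply (NoDup_remove_1 [] _ (rootv f (p ++ [false]) a)).
      eapply Permutation_NoDup; [|exact H2]; simpl; perm.
    + apply (NoDup_remove_1 [] _ (rootv f (p ++ [true]) b)).
      eapply Permutation_NoDup; [|exact H2]; simpl; perm.
Qed.

Lemma NoDup_tedges f sw t p : addressing f -> NoDup (ids t) -> NoDup (tedges f sw p t).
Proof.
  intros Hf Hd; apply (NoDup_map_inv snd).
  assert (H := NoDup_tedges_targets f sw t Hf Hd p); inversion H; auto.
Qed.

Lemma NoDup_sedges sw G : NoDup (map snd (seq_leaves G)) -> forall k, NoDup (sedges sw k G).
Proof.
  induction G as [|it G IH]; simpl; intros Hd k; [constructor|].
  rewrite map_app in Hd; rewrite iedges_itree; apply NoDup_app.
  - apply NoDup_tedges; [apply addressing_VG|].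
    rewrite item_leaves_itree in Hd; apply (NoDup_app_l _ _ Hd).
  - apply IH, (NoDup_app_remove_l _ _ Hd).
  - intros e H1 H2; apply tedges_lengths in H1 as (q & Q & _).
    apply sedges_verts in H2 as (k' & q' & Hk & Q' & _).
    rewrite Q in Q'; injection Q' as ->; lia.
Qed.

Lemma pg_edges_above sw P G u v : In (u, v) (pg_edges sw P G) -> above u v.
Proof.
  intros H; apply in_app_or in H as [H|H].
  - apply tedges_lengths in H as (q & Q & H); simpl in *; subst u.
    destruct H as [[i ->]|(q' & H & ->)]; simpl; auto.
  - apply sedges_verts in H as (k & q & _ & Q & H); simpl in *; subst u.
    destruct H as [[i ->]|(q' & H & ->)]; simpl; auto.
Qed.

Lemma NoDup_pg_edges sw P G :
  NoDup (map snd (seq_leaves G)) -> NoDup (ids P) -> NoDup (pg_edges sw P G).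
Proof.
  intros HG HP; apply NoDup_app.
  - apply NoDup_tedges; auto using addressing_VP.
  - apply NoDup_sedges; auto.
  - intros e H1 H2; apply tedges_lengths in H1 as (q & Q & _).
    apply sedges_verts in H2 as (k' & q' & Hk & Q' & _); congruence.
Qed.

Definition well_formed (P : tree) (G : list item) : Prop :=
  linking P /\ Forall wf_item G /\ NoDup (map snd (seq_leaves G)) /\
  Permutation (leaves P) (seq_leaves G).

Lemma well_formed_ids P G : well_formed P G ->
  NoDup (ids P) /\ forall i, In i (ids P) <-> In i (map snd (seq_leaves G)).
Proof.
  intros (_ & _ & HN & HP); apply (Permutation_map snd) in HP; split.
  - eapply Permutation_NoDup; [symmetry; exact HP|exact HN].
  - intros i; split; apply Permutation_in; [exact HP|symmetry; exact HP].
Qed.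

Lemma proof_graph_well_formed P G : proof_graph P G -> well_formed P G.
Proof. unfold proof_graph, well_formed; tauto. Qed.

Lemma proof_graph_all_trees P G : proof_graph P G -> all_trees true P G.
Proof.
  intros HPG r E EG HE HEG; assert (W := proof_graph_well_formed _ _ HPG).
  destruct (well_formed_ids _ _ W) as [HN HI].
  destruct (coll_switching _ _ _ _ HE) as [s Hs], (seq_coll_switching _ _ HEG) as [sG HsG].
  (* Only ⅋-nodes are switched, so [VLeaf] just receives a default value. *)
  set (sw := fun v => match v with VLeaf _ => true | VP q => s q | VG k q => sG k q end).
  apply (tree_on_pg_edges true sw P G r E EG); [apply Hs; auto|apply HsG; auto|].
  destruct HPG as (_ & _ & HG & _ & HPG); destruct (HPG sw) as [HC HA]; split.
  - intros u v (i & -> & Hi) (j & -> & Hj); apply HC; apply in_or_app; left;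
      apply ids_tverts, HI; auto.
  - apply acyclic_forest; auto using NoDup_pg_edges.
    intros u v H; apply pg_edges_above in H as H'; split.
    + intros ->; exact (above_asym _ _ H' H').
    + intros H2; apply pg_edges_above in H2; exact (above_asym _ _ H' H2).
Qed.

Lemma all_trees_proof_graph P G :
  well_formed P G -> all_trees false P G -> proof_graph P G.
Proof.
  intros W H; destruct (well_formed_ids _ _ W) as [HN HI].
  destruct W as (HL & HW & HG & HP); repeat (split; [assumption|]); intros sw.
  destruct (tcoll_exists VP sw P []) as (r & E & HE), (seq_tcoll_exists sw G 0) as [EG HEG].
  specialize (H r E EG (tcoll_coll _ _ _ _ _ _ _ HE) (seq_tcoll_coll _ _ _ _ HEG)).
  apply (tree_on_pg_edges _ _ _ _ _ _ _ HE HEG) in H as [HC HF].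
  split; [|apply forest_acyclic, HF].
  assert (L : forall u, In u (pg_verts P G) ->
    exists i, In i (map snd (seq_leaves G)) /\ conn (pg_edges sw P G) u (VLeaf i)).
  { intros u Hu; apply in_app_or in Hu as [Hu|Hu].
    - apply (tverts_conn _ sw) in Hu as (i & Hi & Hu); exists i; split; [apply HI, Hi|].
      revert Hu; apply conn_incl, incl_appl, incl_refl.
    - apply (sverts_conn sw) in Hu as (i & Hi & Hu); exists i; split; [exact Hi|].
      revert Hu; apply conn_incl, incl_appr, incl_refl. }
  intros u v Hu Hv; apply L in Hu as (i & Hi & Hu), Hv as (j & Hj & Hv).
  eapply conn_trans; [exact Hu|]; eapply conn_trans; [|apply conn_sym, Hv].
  apply HC; eexists; eauto.
Qed.

(** * Linking contexts *)

Fixpoint cids (C : ctx) : list nat :=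
  match C with
  | Hole => []
  | CTL C t | CTR t C | CPL C t | CPR t C => ids t ++ cids C
  end.

Lemma ids_plug C t : Permutation (ids (plug C t)) (ids t ++ cids C).
Proof.
  induction C as [|C IH u|u C IH|C IH u|u C IH]; simpl;
    rewrite ?app_nil_r, ?ids_tens, ?ids_par, ?IH; auto; perm.
Qed.

Lemma leaves_plug C X Y :
  Permutation (leaves X) (leaves Y) -> Permutation (leaves (plug C X)) (leaves (plug C Y)).
Proof. intros H; induction C; simpl; auto using Permutation_app. Qed.

Lemma tedges_plug f sw C t : forall p,
  incl (tedges f sw (p ++ hole_path C) t) (tedges f sw p (plug C t)).
Proof.
  induction C as [|C IH u|u C IH|C IH u|u C IH]; intros p; simpl;
    [rewrite app_nil_r; apply incl_refl|..];
    intros e He; change (false :: hole_path C) with ([false] ++ hole_path C) in *;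
    change (true :: hole_path C) with ([true] ++ hole_path C) in *;
    rewrite app_assoc in He; apply IH in He; simpl; rewrite in_app_iff; auto.
Qed.

Fixpoint ccomp (C D : ctx) : ctx :=
  match C with
  | Hole => D
  | CTL C t => CTL (ccomp C D) t
  | CTR t C => CTR t (ccomp C D)
  | CPL C t => CPL (ccomp C D) t
  | CPR t C => CPR t (ccomp C D)
  end.

Lemma plug_ccomp C D t : plug (ccomp C D) t = plug C (plug D t).
Proof. induction C; simpl; congruence. Qed.

(** A leaf in the hole may be an atom or bottom inside a link, which is not a linking on its own; an
    internal subtree of a linking always is one. *)
Definition internal (t : tree) : Prop := match t with Lf _ _ => False | _ => True end.

Lemma linking_plug C X : linking (plug C X) -> internal X ->
  linking X /\ forall Y, linking Y -> linking (plug C Y).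
Proof.
  assert (N : forall C l i, internal X -> plug C X <> Lf l i)
    by (intros [] l i; simpl; try discriminate; destruct X; simpl; try discriminate; tauto).
  intros H HX; induction C as [|C IH u|u C IH|C IH u|u C IH]; simpl in *; auto;
    inversion H; subst;
    match goal with
    | Q : Lf _ _ = plug C X |- _ => symmetry in Q; destruct (N _ _ _ HX Q)
    | H : linking (plug C X) |- _ =>
        destruct (IH H) as [H5 H6]; split; [exact H5|intros Y HY; constructor; auto]
    end.
Qed.

(** [ctx_coll C rho EC]: a collapse of the context [C]; when the hole is filled by a
    tree represented by leaf [r], the whole is represented by [rho r] and the context
    contributes the edges [EC r]. *)
Inductive ctx_coll : ctx -> (nat -> nat) -> (nat -> list edge) -> Prop :=
| cc_hole : ctx_coll Hole (fun x => x) (fun _ => [])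
| cc_tl C t rho EC r E : ctx_coll C rho EC -> coll false t r E ->
    ctx_coll (CTL C t) rho (fun x => (VLeaf (rho x), VLeaf r) :: EC x ++ E)
| cc_tr C t rho EC r E : ctx_coll C rho EC -> coll false t r E ->
    ctx_coll (CTR t C) (fun _ => r) (fun x => (VLeaf r, VLeaf (rho x)) :: E ++ EC x)
| cc_pl_in C t rho EC r E : ctx_coll C rho EC -> coll false t r E ->
    ctx_coll (CPL C t) rho (fun x => EC x ++ E)
| cc_pl_out C t rho EC r E : ctx_coll C rho EC -> coll false t r E ->
    ctx_coll (CPL C t) (fun _ => r) (fun x => EC x ++ E)
| cc_pr_out C t rho EC r E : ctx_coll C rho EC -> coll false t r E ->
    ctx_coll (CPR t C) (fun _ => r) (fun x => E ++ EC x)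
| cc_pr_in C t rho EC r E : ctx_coll C rho EC -> coll false t r E ->
    ctx_coll (CPR t C) rho (fun x => E ++ EC x).

Lemma coll_plug_inv C Y : forall R E, coll false (plug C Y) R E ->
  exists rho EC r0 E0, ctx_coll C rho EC /\ coll false Y r0 E0 /\
    R = rho r0 /\ Permutation E (E0 ++ EC r0).
Proof.
  induction C as [|C IH u|u C IH|C IH u|u C IH]; simpl; intros R E H.
  - exists (fun x => x), (fun _ => []), R, E.
    repeat split; [constructor|exact H|rewrite app_nil_r; auto].
  - inversion H; subst; [|discriminate].
    match goal with H : coll false (plug C Y) _ _ |- _ =>
      apply IH in H as (rho & EC & r0 & E0 & HC & HY & -> & HP) end.
    do 4 eexists; split; [eapply cc_tl; eauto|split; [eauto|split; [reflexivity|rewrite HP; perm]]].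
  - inversion H; subst; [|discriminate].
    match goal with H : coll false (plug C Y) _ _ |- _ =>
      apply IH in H as (rho & EC & r0 & E0 & HC & HY & -> & HP) end.
    do 4 eexists; split; [eapply cc_tr; eauto|split; [eauto|split; [reflexivity|rewrite HP; perm]]].
  - inversion H as [| | |? ? r1 r2 E1 E2 H1 H2|? ? r1 r2 E1 E2 H1 H2]; subst;
      apply IH in H1 as (rho & EC & r0 & E0 & HC & HY & -> & HP);
      [exists rho|exists (fun _ => R)]; exists (fun x => EC x ++ E2), r0, E0;
      (split; [econstructor; eassumption|]);
      (split; [exact HY|split; [reflexivity|rewrite HP; perm]]).
  - inversion H as [| | |? ? r1 r2 E1 E2 H1 H2|? ? r1 r2 E1 E2 H1 H2]; subst;
      apply IH in H2 as (rho & EC & r0 & E0 & HC & HY & -> & HP);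
      [exists (fun _ => R)|exists rho]; exists (fun x => E1 ++ EC x), r0, E0;
      (split; [econstructor; eassumption|]);
      (split; [exact HY|split; [reflexivity|rewrite HP; perm]]).
Qed.

(** Counterpart of [coll_plug_inv]: a context collapse taken from one tree is reused around another
    subtree, given the same representative for the hole. *)
Lemma coll_plug C rho EC : ctx_coll C rho EC -> forall X r E, coll true X r E ->
  exists E', coll true (plug C X) (rho r) E' /\ Permutation E' (E ++ EC r).
Proof.
  induction 1 as [|C t rho EC r E H IH HT|C t rho EC r E H IH HT|C t rho EC r E H IH HT
    |C t rho EC r E H IH HT|C t rho EC r E H IH HT|C t rho EC r E H IH HT];
    intros X r1 E1 HX; [exists E1; split; [exact HX|rewrite app_nil_r; auto]|..];
    apply coll_true in HT; destruct (IH _ _ _ HX) as (E' & HE & HP); simpl.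
  - eexists; split; [apply coll_tens_l; eauto|rewrite HP; perm].
  - eexists; split; [apply coll_tens_l; eauto|rewrite HP; perm].
  - eexists; split; [eapply coll_par_l; eauto|rewrite HP; perm].
  - eexists; split; [eapply coll_par_r; eauto|rewrite HP; perm].
  - eexists; split; [eapply coll_par_l; eauto|rewrite HP; perm].
  - eexists; split; [eapply coll_par_r; eauto|rewrite HP; perm].
Qed.

Lemma ctx_coll_rep C rho EC : ctx_coll C rho EC ->
  (forall x, rho x = x) \/ exists c, In c (cids C) /\ forall x, rho x = c.
Proof.
  induction 1 as [|C t rho EC r E H IH HT|C t rho EC r E H IH HT|C t rho EC r E H IH HT
    |C t rho EC r E H IH HT|C t rho EC r E H IH HT|C t rho EC r E H IH HT]; auto;
    try (apply coll_ids in HT as [HT _]; right; exists r; simpl; split; auto;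
      apply in_or_app; auto; fail);
    destruct IH as [IH|(c & Hc & IH)]; auto; right; exists c; simpl;
      split; auto; apply in_or_app; auto.
Qed.

(** Apart from the edges at the leaf representing the hole, the edges contributed by a
    context do not depend on how the hole is filled. *)
Lemma ctx_coll_local C rho EC : ctx_coll C rho EC -> forall r e, In e (EC r) ->
  (fst e = VLeaf r \/ snd e = VLeaf r) \/ forall r', In e (EC r').
Proof.
  induction 1 as [|C t rho EC r E H IH HT|C t rho EC r E H IH HT|C t rho EC r E H IH HT
    |C t rho EC r E H IH HT|C t rho EC r E H IH HT|C t rho EC r E H IH HT];
    intros x e He; simpl in He; [contradiction|..].
  1,2: destruct He as [<-|He];
    [destruct (ctx_coll_rep _ _ _ H) as [Hr|(c & _ & Hr)]; simpl;
      [rewrite Hr; auto|right; intros; rewrite !Hr; auto]|].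
  all: apply in_app_or in He as [He|He];
    try (right; intros; simpl; rewrite in_app_iff; auto; fail);
    destruct (IH _ _ He); auto; right; intros; simpl; rewrite in_app_iff; auto.
Qed.

Lemma ctx_coll_ids C rho EC : ctx_coll C rho EC -> forall r e, In e (EC r) ->
  exists i j, e = (VLeaf i, VLeaf j) /\ In i (r :: cids C) /\ In j (r :: cids C).
Proof.
  induction 1 as [|C t rho EC r E H IH HT|C t rho EC r E H IH HT|C t rho EC r E H IH HT
    |C t rho EC r E H IH HT|C t rho EC r E H IH HT|C t rho EC r E H IH HT];
    intros x e He; simpl in He; [contradiction|..];
    apply coll_ids in HT as [Hr HT].
  1,2: destruct He as [<-|He];
    [do 2 eexists; split; [reflexivity|];
     destruct (ctx_coll_rep _ _ _ H) as [Hx|(c & Hc & Hx)]; rewrite Hx;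
     simpl; rewrite !in_app_iff; auto|].
  all: apply in_app_or in He as [He|He];
    first [apply IH in He|apply HT in He]; destruct He as (i & j & -> & Hi & Hj);
    exists i, j; simpl in *; rewrite !in_app_iff; tauto.
Qed.

(** * Rewriting steps on proof graphs *)

(** Conditional on [P] being a proof graph, since moves of bottoms are justified only there. In this
    form steps compose without carrying the invariant along. *)
Definition evolves (G : list item) (P P' : tree) : Prop :=
  proof_graph P G -> proof_graph P' G /\ pg_equiv G P P'.

Lemma evolves_refl G P : evolves G P P.
Proof. intros H; split; [exact H|apply rst_refl]. Qed.

Lemma evolves_trans G P Q R : evolves G P Q -> evolves G Q R -> evolves G P R.
Proof.
  intros H1 H2 H; destruct (H1 H) as [HQ E1], (H2 HQ) as [HR E2].
  split; [exact HR|eapply rst_trans; eauto].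
Qed.

Lemma well_formed_plug C X Y G : well_formed (plug C X) G -> internal X ->
  (linking X -> linking Y) -> Permutation (leaves X) (leaves Y) -> well_formed (plug C Y) G.
Proof.
  intros (HL & HW & HN & HP) HX HXY HPL; destruct (linking_plug _ _ HL HX) as [H1 H2].
  repeat split; auto. rewrite <- HP; symmetry; apply leaves_plug, HPL.
Qed.

(** If each collapse of [Y] is already a collapse of [X] with the same representative and edges,
    then every tree required of the new graph is one of the old. *)
Lemma evolves_local G C X Y : internal X -> (linking X -> linking Y) ->
  Permutation (leaves X) (leaves Y) ->
  (forall r E, coll false Y r E -> exists E', coll true X r E' /\ Permutation E E') ->
  pg_equiv G (plug C X) (plug C Y) -> evolves G (plug C X) (plug C Y).
Proof.
  intros HX HL HP HC HE H; split; [|exact HE].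
  apply all_trees_proof_graph.
  - eapply well_formed_plug; eauto; apply proof_graph_well_formed, H.
  - apply proof_graph_all_trees in H; intros R E EG HR HG.
    apply coll_plug_inv in HR as (rho & EC & r0 & E0 & H1 & H2 & -> & H3).
    destruct (HC _ _ H2) as (E1 & H4 & H5), (coll_plug _ _ _ H1 _ _ _ H4) as (E2 & H6 & H7).
    apply (tree_on_perm _ _ (E2 ++ EG)); [|eapply H; eauto].
    rewrite H3, H7, H5; reflexivity.
Qed.

Lemma evolves_par_comm G C Q R : evolves G (plug C (Par Q R)) (plug C (Par R Q)).
Proof.
  apply evolves_local; simpl; auto using Permutation_app_comm.
  - intros H; inversion H; subst; constructor; auto.
  - intros r E H; apply coll_true in H; inversion H; subst;
      (eexists; split; [|apply Permutation_app_comm]);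
      [eapply coll_par_r|eapply coll_par_l]; eauto.
  - apply rst_step; constructor.
Qed.

Lemma evolves_par_assoc G C Q R S :
  evolves G (plug C (Par (Par Q R) S)) (plug C (Par Q (Par R S))).
Proof.
  apply evolves_local; simpl; auto.
  - intros H; inversion H as [| | | | |? ? H1 H2]; inversion H1; subst;
      repeat constructor; auto.
  - rewrite <- app_assoc; auto.
  - intros r E H; apply coll_true in H; inversion H; subst;
    match goal with H : coll true (Par R S) _ _ |- _ => inversion H; subst end;
    (eexists; split; [|rewrite app_assoc; apply Permutation_refl]);
      first [ eapply coll_par_l; [eapply coll_par_l; eassumption|eassumption]
            | eapply coll_par_l; [eapply coll_par_r; eassumption|eassumption]
            | eapply coll_par_r; [eapply coll_par_l; eassumption|eassumption] ].
  - apply rst_sym, rst_step; constructor.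
Qed.

Lemma evolves_tens_comm G C Q R : evolves G (plug C (Tens Q R)) (plug C (Tens R Q)).
Proof.
  apply evolves_local; simpl; auto using Permutation_app_comm.
  - intros H; inversion H; subst; constructor; auto.
  - intros r E H; inversion H; subst; [|discriminate].
    (* The left child of the new tensor is the right child of the old one, so the old tensor must be
       represented on its right. *)
    eexists; split; [apply coll_tens_r; eauto using coll_true|perm].
  - apply rst_step; constructor.
Qed.

(** * Moving bottoms *)

Section Jump.
Variables (G : list item) (C : ctx) (M : tree) (m : nat).
Hypothesis HT : all_trees true (plug C (Tens M (Lf Bot m))) G.
Hypothesis HN : NoDup (ids (plug C (Tens M (Lf Bot m)))).

Variables (rho : nat -> nat) (EC : nat -> list edge) (EG : list edge).
Hypothesis HC : ctx_coll C rho EC.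
Hypothesis HG : seq_coll G EG.

Lemma jump_tree r E : coll true M r E ->
  tree_on (leafset G) ((VLeaf r, VLeaf m) :: E ++ EC r ++ EG).
Proof.
  intros H.
  assert (H' : coll true (Tens M (Lf Bot m)) r ((VLeaf r, VLeaf m) :: E ++ []))
    by (apply coll_tens_l; [exact H|constructor]).
  destruct (coll_plug _ _ _ HC _ _ _ H') as (E' & HE & HP).
  apply (tree_on_perm _ _ (E' ++ EG)); [rewrite HP; perm|eapply HT; eauto].
Qed.

Lemma jump_fresh : ~ In m (ids M) /\ ~ In m (cids C).
Proof.
  assert (H := Permutation_NoDup (ids_plug _ _) HN); rewrite ids_tens, <- app_assoc in H.
  apply NoDup_remove_2 in H; rewrite in_app_iff in H; tauto.
Qed.

(** On a path from a leaf of [M] to the bottom, consider the part after the last leaf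
    [x] of [M]: it survives in the switching that represents [M] by [x], where it would
    close a cycle. *)
Lemma jump_unreachable r0 EM x : coll true M r0 EM -> In x (ids M) ->
  ~ conn (EM ++ EC r0 ++ EG) (VLeaf x) (VLeaf m).
Proof.
  intros HM Hx HP; destruct jump_fresh as [Hm _].
  set (inM := fun u => exists x, u = VLeaf x /\ In x (ids M)).
  (* Induction backwards from the bottom. Quantifying over every representative [r] makes the
     traversed part of the path available in whichever switching will be chosen when a leaf of [M]
     is met. *)
  enough (H : forall u, conn (EM ++ EC r0 ++ EG) u (VLeaf m) ->
    ~ inM u /\ forall r, conn (EC r ++ EG) u (VLeaf m)) by (apply H in HP as [HP _]; apply HP; exists x; auto).
  clear x Hx HP; intros u H; apply clos_rt_rt1n in H.
  remember (VLeaf m) as z eqn:Z; induction H as [u|u y z Hs _ IH]; subst.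
  - split; [intros (x & Q & Hx); injection Q as <-; auto|intros; apply rt_refl].
  - destruct (IH eq_refl) as [Hy Hc]; clear IH.
    assert (Hr0 : In r0 (ids M)) by (eapply coll_ids; eauto).
    assert (L : (forall r, conn (EC r ++ EG) u y) ->
      ~ inM u /\ forall r, conn (EC r ++ EG) u (VLeaf m)).
    { intros Hu; split; [|intros r; eapply conn_trans; eauto].
      intros (x & -> & Hx); destruct (coll_any_rep _ _ Hx) as [E HE].
      apply jump_tree in HE as [_ [HB _]]; apply HB.
      generalize (conn_trans _ _ _ _ (Hu x) (Hc x)); apply conn_incl, incl_appr, incl_refl. }
    assert (He : exists e, In e (EM ++ EC r0 ++ EG) /\ (e = (u, y) \/ e = (y, u)))
      by (destruct Hs; eauto).
    destruct He as (e & He & Huy).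
    assert (Ke : forall E, In e E -> conn E u y).
    { intros E HE; destruct Huy as [-> | ->]; [|apply conn_sym]; apply conn_edge, HE. }
    apply in_app_or in He as [He|He]; [|apply in_app_or in He as [He|He]].
    + exfalso; apply Hy; apply coll_ids in HM as [_ HM].
      apply HM in He as (i & j & -> & Hi & Hj).
      destruct Huy as [Q|Q]; injection Q as <- <-; eexists; eauto.
    + destruct (ctx_coll_local _ _ _ HC _ _ He) as [Ht|Hl].
      (* An edge that depends on the representative touches [r0]. As [y] is outside [M], the path
         has just arrived from [r0], and the current collapse already contains the cycle. *)
      * assert (Hu : u = VLeaf r0).
        { destruct Huy as [-> | ->], Ht as [Ht|Ht]; simpl in Ht; auto;
            destruct Hy; exists r0; auto. }
        exfalso; apply jump_tree in HM as [_ [HB _]]; apply HB; rewrite <- Hu.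
        apply (conn_incl (EC r0 ++ EG)); [apply incl_appr, incl_refl|].
        eapply conn_trans; [|apply Hc]; apply Ke, in_or_app; auto.
      * apply L; intros r; apply Ke, in_or_app; auto.
    + apply L; intros r; apply Ke, in_or_app; auto.
Qed.

(** The tree of [jump_tree] joins the two leaves. A path crossing the edge at the bottom would
    connect one of them to the bottom by other edges, against [jump_unreachable]. *)
Lemma jump_connected r0 EM x y : (forall i, In i (ids M) -> leafset G (VLeaf i)) ->
  coll true M r0 EM -> In x (ids M) -> In y (ids M) ->
  conn (EM ++ EC r0 ++ EG) (VLeaf x) (VLeaf y).
Proof.
  intros HL HM Hx Hy; destruct (jump_tree _ _ HM) as [H _].
  destruct (conn_cons _ _ _ _ _ (H _ _ (HL x Hx) (HL y Hy))) as [H1|[[_ H1]|[H1 _]]];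
    [exact H1|exfalso; apply conn_sym in H1|exfalso];
    revert H1; apply jump_unreachable; auto.
Qed.
End Jump.

Lemma leafset_plug C X G i : well_formed (plug C X) G -> In i (ids X) -> leafset G (VLeaf i).
Proof.
  intros H Hi; apply well_formed_ids in H as [_ H]; exists i; split; [auto|].
  apply H, (Permutation_in _ (Permutation_sym (ids_plug C X))), in_or_app; auto.
Qed.

Lemma coll_leaf_inv nd l i r E : coll nd (Lf l i) r E -> r = i /\ E = [].
Proof. intros H; inversion H; auto. Qed.

(** If the ⅋ is switched to [R], both graphs collapse to the same edges. If it is switched to [Q],
    the bottom hangs from the representative of [R] instead of that of [Q]; the two are connected by
    [jump_connected], so its edge can slide. *)
Lemma push_bot_proof_graph G C Q R m :
  proof_graph (plug C (Tens (Par Q R) (Lf Bot m))) G ->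
  proof_graph (plug C (Par Q (Tens R (Lf Bot m)))) G.
Proof.
  intros H; assert (W := proof_graph_well_formed _ _ H).
  assert (HL : forall i, In i (ids (Par Q R)) -> leafset G (VLeaf i)).
  { intros i Hi; eapply leafset_plug; [exact W|rewrite ids_tens; apply in_or_app; auto]. }
  destruct (well_formed_ids _ _ W) as [HN _].
  apply proof_graph_all_trees in H; apply all_trees_proof_graph.
  - eapply well_formed_plug; [exact W|exact I| |simpl; rewrite app_assoc; auto].
    intros HX; inversion HX as [| | | |? ? HX'|]; inversion HX'; subst; repeat constructor; auto.
  - intros r E EG HR HG.
    apply coll_plug_inv in HR as (rho & EC & r0 & E0 & HC & H0 & -> & HP).
    rewrite (tree_on_perm _ _ (E0 ++ EC r0 ++ EG)) by (rewrite HP; perm).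
    inversion H0 as [| | |? ? rq rr EQ ER HQ HR|? ? rq rr EQ ER HQ HR]; subst; clear H0;
      inversion HR as [|? ? ? ? ER' ? HR' HB| | |]; subst; try discriminate;
      apply coll_leaf_inv in HB as [-> ->]; clear HR; apply coll_true in HQ, HR'.
    + assert (HM := coll_par_l _ _ _ _ _ _ _ HQ HR').
      rewrite (tree_on_perm _ _ ((VLeaf rr, VLeaf m) :: (EQ ++ ER') ++ EC r0 ++ EG)) by perm.
      apply (tree_on_exchange _ _ (VLeaf r0)).
      * apply coll_ids in HQ as [HQ _]; apply coll_ids in HR' as [HR _].
        apply (jump_connected G C _ m H HN rho EC EG HC HG); auto;
          rewrite ids_par; apply in_or_app; auto.
      * apply (jump_tree G C (Par Q R) m H rho); auto.
    + assert (HM := coll_par_r _ _ _ _ _ _ _ HQ HR').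
      rewrite (tree_on_perm _ _ ((VLeaf r0, VLeaf m) :: (EQ ++ ER') ++ EC r0 ++ EG)) by perm.
      apply (jump_tree G C (Par Q R) m H rho); auto.
Qed.

(** * The side condition, in the graph itself *)

Lemma conn_avoiding_edge E x y e :
  In e E -> fst e <> y -> e <> (x, y) ->
  clos_refl_trans vert (adj_minus E x y) (fst e) (snd e).
Proof.
  destruct e as [u w]; simpl; intros H1 H2 H3; apply rt_step; split; [left; exact H1|].
  intros [[-> ->]|[-> _]]; auto.
Qed.

Lemma adj_minus_equiv E x y : equivalence vert (clos_refl_trans vert (adj_minus E x y)).
Proof.
  split.
  - intros a; apply rt_refl.
  - intros a b c; apply rt_trans.
  - intros a b; apply clos_rt_sym; apply adj_minus_sym.
Qed.

(** The way back from collapses: a collapsed edge stands for a path through the contracted nodes,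
    and if neither of its ends is [x], that path takes no edge into [x]. Here [x] will be the
    bottom, which is reached in the linking only by its own edge. *)
Lemma tcoll_realize nd f sw p t r E (K : relation vert) x :
  equivalence vert K -> (forall q, f q <> x) -> tcoll nd f sw p t r E ->
  (forall e, In e (tedges f sw p t) -> snd e <> x -> K (fst e) (snd e)) ->
  (VLeaf r <> x -> K (rootv f p t) (VLeaf r)) /\
  forall e, In e E -> fst e <> x -> snd e <> x -> K (fst e) (snd e).
Proof.
  intros [Kr Kt Ks] Hx H.
  assert (N : forall p t r E, tcoll nd f sw p t r E -> VLeaf r <> x -> rootv f p t <> x).
  { intros p' t' r' E' H' Hr; destruct (rootv_cases f p' t') as [(l & i & -> & Q)| ->]; auto.
    inversion H'; subst; exact Hr. }
  assert (S : forall p b t r (E : list edge) E', tcoll nd f sw (p ++ [b]) t r E ->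
    incl (tedges f sw (p ++ [b]) t) E' ->
    (forall e, In e E' -> snd e <> x -> K (fst e) (snd e)) ->
    ((forall e, In e (tedges f sw (p ++ [b]) t) -> snd e <> x -> K (fst e) (snd e)) ->
     (VLeaf r <> x -> K (rootv f (p ++ [b]) t) (VLeaf r)) /\
     forall e, In e E -> fst e <> x -> snd e <> x -> K (fst e) (snd e)) ->
    (In (f p, rootv f (p ++ [b]) t) E' -> VLeaf r <> x -> K (f p) (VLeaf r)) /\
     forall e, In e E -> fst e <> x -> snd e <> x -> K (fst e) (snd e)).
  { intros p' b t' r' E1 E2 H1 HI HE IH; destruct IH as [IH1 IH2]; [auto|].
    split; [|exact IH2]; intros He Hr; eapply Kt; [|apply IH1, Hr].
    apply (HE _ He); simpl; eauto. }
  induction H as [p l i|p a b r1 r2 E1 E2 H1 IH1 H2 IH2|p a b r1 r2 E1 E2 _ H1 IH1 H2 IH2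
    |p a b r1 r2 E1 E2 Hs H1 IH1 H2 IH2|p a b r1 r2 E1 E2 Hs H1 IH1 H2 IH2]; intros HE;
    [split; [intros; apply Kr|intros e []]|..];
    match type of HE with forall e, In e ?E -> _ =>
      assert (I1 : incl (tedges f sw (p ++ [false]) a) E)
        by (intros e He; simpl; rewrite in_app_iff; auto);
      assert (I2 : incl (tedges f sw (p ++ [true]) b) E)
        by (intros e He; simpl; rewrite in_app_iff; auto)
    end;
    destruct (S _ _ _ _ _ _ H1 I1 HE IH1) as [J1 J1'];
    destruct (S _ _ _ _ _ _ H2 I2 HE IH2)
      as [J2 J2']; simpl in J1, J2; try rewrite Hs in J1, J2;
    simpl; (split; [auto|]); intros e He.
  1,2: destruct He as [<-|He]; [simpl; intros; apply Kt with (f p); [apply Ks|]; auto|].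
  all: apply in_app_or in He as [He|He]; auto.
Qed.

Lemma seq_tcoll_realize sw k G EG (K : relation vert) :
  equivalence vert K -> seq_tcoll sw k G EG ->
  (forall e, In e (sedges sw k G) -> K (fst e) (snd e)) ->
  forall e, In e EG -> K (fst e) (snd e).
Proof.
  intros HK H; induction H as [|k it G r E EG H1 H2 IH]; simpl; intros HE e He; [destruct He|].
  rewrite iedges_itree in HE; apply in_app_or in He as [He|He].
  (* A dummy for the excluded vertex: [VP []] is neither a node of the sequent nor a leaf, so
     nothing is excluded. *)
  - assert (Hx : forall q, VG k q <> VP []) by congruence.
    destruct (tcoll_realize _ _ _ _ _ _ _ K (VP []) HK Hx H1) as [_ HR].
    + intros e' He' _; apply HE, in_or_app; auto.
    + apply tcoll_coll, coll_ids in H1 as [_ H1]; assert (He' := He).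
      apply H1 in He' as (i & j & -> & _); apply HR; simpl; auto; discriminate.
  - apply IH; auto; intros e' He'; apply HE, in_or_app; auto.
Qed.

Lemma pg_edges_source sw P G e i : In e (pg_edges sw P G) -> fst e <> VLeaf i.
Proof. destruct e as [u w]; intros H; apply pg_edges_above in H; destruct u; easy. Qed.

Lemma tedges_not_leaf f sw p t e q i : addressing f -> In e (tedges f sw p t) ->
  (forall q', q <> p ++ q') -> e <> (f q, VLeaf i).
Proof.
  intros Hf H Hq ->; apply tedges_verts in H as [[q' H] _]; apply Hf in H; simpl in H.
  exact (Hq _ H).
Qed.

Section BotEdge.
Variables (sw : vert -> bool) (G : list item) (C : ctx) (Q R : tree) (m : nat).

(** [p] is the address of the tensor of [R] with the bottom; [K] is connectivity without the edge
    from that tensor to the bottom, the relation of [side_cond]. *)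
Let p := hole_path C ++ [true].
Let E := pg_edges sw (plug C (Par Q (Tens R (Lf Bot m)))) G.
Let K := clos_refl_trans vert (adj_minus E (VP p) (VLeaf m)).

Lemma bot_edge_equiv : equivalence vert K.
Proof. apply adj_minus_equiv. Qed.

Lemma bot_edge_keep e : In e E -> e <> (VP p, VLeaf m) -> K (fst e) (snd e).
Proof. intros H; apply conn_avoiding_edge; auto; eapply pg_edges_source; eauto. Qed.

Lemma bot_edge_subtree e :
  In e (tedges VP sw (hole_path C) (Par Q (Tens R (Lf Bot m)))) -> In e E.
Proof. intros H; apply in_or_app; left; apply (tedges_plug VP sw C _ []), H. Qed.

Lemma bot_edge_left u v : conn (tedges VP sw (hole_path C ++ [false]) Q) u v -> K u v.
Proof.
  apply conn_realize; [apply bot_edge_equiv|]; intros e He; apply bot_edge_keep.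
  - apply bot_edge_subtree; simpl; rewrite in_app_iff; auto.
  - eapply tedges_not_leaf; eauto using addressing_VP.
    intros q' Hq; unfold p in Hq; rewrite <- app_assoc in Hq; apply app_inv_head in Hq; discriminate.
Qed.

Lemma bot_edge_right u v : conn (tedges VP sw (p ++ [false]) R) u v -> K u v.
Proof.
  apply conn_realize; [apply bot_edge_equiv|]; intros e He; apply bot_edge_keep.
  - apply bot_edge_subtree; simpl; rewrite in_app_iff; simpl; rewrite in_app_iff.
    unfold p in He; auto 10.
  - eapply tedges_not_leaf; eauto using addressing_VP.
    intros q' Hq; rewrite <- (app_nil_r p), <- !app_assoc in Hq; apply app_inv_head in Hq.
    discriminate.
Qed.

Lemma bot_edge_root_right : (forall i, In i (ids R) -> i <> m) ->
  K (VP p) (rootv VP (p ++ [false]) R).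
Proof.
  intros Hm; apply (bot_edge_keep (VP p, rootv VP (p ++ [false]) R)).
  - apply bot_edge_subtree; simpl; rewrite in_app_iff; simpl; auto.
  - destruct (rootv_cases VP (p ++ [false]) R) as [(l & i & Q' & ->)| ->]; [|congruence].
    intros H; injection H as ->; apply (Hm m); auto; rewrite Q'; left; auto.
Qed.

Lemma bot_edge_sequent e : In e (sedges sw 0 G) -> K (fst e) (snd e).
Proof.
  intros He; apply bot_edge_keep; [apply in_or_app; auto|].
  intros ->; apply sedges_verts in He as (k & q & _ & H & _); discriminate.
Qed.

Lemma bot_edge_bridge :
  proof_graph (plug C (Par Q (Tens R (Lf Bot m)))) G -> ~ K (VP p) (VLeaf m).
Proof.
  intros (_ & _ & _ & _ & H); apply acyclic_bridge; [apply H| |discriminate].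
  apply bot_edge_subtree; simpl; rewrite in_app_iff; simpl; auto.
Qed.
End BotEdge.

Lemma rootv_tverts f p t : In (rootv f p t) (tverts f p t).
Proof. destruct t; simpl; auto. Qed.

(** A node [v] of [Q] reaching the bottom would bypass its edge, which is a bridge: from the tensor
    down to a leaf [i] of [R], across to a leaf [j] of [Q], then to [v] and to the bottom. The
    crossing from [i] to [j] is [jump_connected], lifted to the graph. *)
Lemma push_bot_side_cond G C Q R m :
  proof_graph (plug C (Tens (Par Q R) (Lf Bot m))) G -> side_cond G C Q R m.
Proof.
  intros H sw v Hv HK. assert (H' := push_bot_proof_graph _ _ _ _ _ H).
  assert (W := proof_graph_well_formed _ _ H).
  destruct (well_formed_ids _ _ W) as [HN _].
  assert (HL : forall i, In i (ids (Par Q R)) -> leafset G (VLeaf i)).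
  { intros i Hi; eapply leafset_plug; [exact W|rewrite ids_tens; apply in_or_app; auto]. }
  apply proof_graph_all_trees in H; destruct (jump_fresh _ _ _ HN) as [Hm Hm'].
  rewrite ids_par, in_app_iff in Hm.
  apply (bot_edge_bridge sw G C Q R m H').
  set (P := plug C (Par Q (Tens R (Lf Bot m)))) in *.
  set (K := clos_refl_trans vert (adj_minus (pg_edges sw P G)
    (VP (hole_path C ++ [true])) (VLeaf m))).
  assert (HE : equivalence vert K) by apply adj_minus_equiv.
  destruct (tverts_conn VP sw Q _ _ Hv) as (j & Hj & Hvj).
  apply (bot_edge_left sw G C Q R m) in Hvj.
  destruct (tverts_conn VP sw R _ _ (rootv_tverts VP ((hole_path C ++ [true]) ++ [false]) R))
    as (i & Hi & Hri); apply (bot_edge_right sw G C Q R m) in Hri.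
  assert (Hroot := bot_edge_root_right sw G C Q R m).
  destruct (tcoll_exists VP sw P []) as (r & E & Ht), (seq_tcoll_exists sw G 0) as [EG HtG].
  assert (HG := seq_tcoll_coll _ _ _ _ HtG).
  assert (Hx : forall q, VP q <> VLeaf m) by discriminate.
  destruct (tcoll_realize _ _ _ _ _ _ _ K (VLeaf m) HE Hx Ht) as [_ HRE].
  { intros e He Hem; apply bot_edge_keep; [apply in_or_app; auto|intros ->; auto]. }
  assert (HRG := seq_tcoll_realize _ _ _ _ K HE HtG (bot_edge_sequent sw G C Q R m)).
  destruct HE as [Kr Kt Ks].
  enough (Kji : K (VLeaf j) (VLeaf i)).
  { apply Kt with (1 := Hroot ltac:(intros i' Hi' ->; tauto)), Kt with (1 := Hri).
    apply Kt with (1 := Ks _ _ Kji), Kt with (1 := Ks _ _ Hvj), HK. }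
  apply tcoll_coll, coll_plug_inv in Ht as (rho & EC & r0 & E0 & HC & H0 & -> & HP).
  (* Dropping the edge of the bottom leaves a collapse of Q ⅋ R with the same representative, to
     which the jump lemmas apply. *)
  assert (HM : exists EM, coll true (Par Q R) r0 EM /\ incl EM E0).
  { inversion H0 as [| | |? ? rq rr EQ ER HQ HR|? ? rq rr EQ ER HQ HR]; subst; clear H0;
      inversion HR as [|? ? ? ? ER' ? HR' HB| | |]; subst; try discriminate;
      apply coll_leaf_inv in HB as [-> ->]; apply coll_true in HQ, HR'; exists (EQ ++ ER');
      (split; [first [eapply coll_par_l; eassumption|eapply coll_par_r; eassumption]|]);
      intros e He; rewrite in_app_iff in *; simpl; rewrite in_app_iff; tauto. }
  destruct HM as (EM & HM & HI).
  assert (C1 : conn (EM ++ EC r0 ++ EG) (VLeaf j) (VLeaf i)).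
  { apply (jump_connected G C (Par Q R) m H HN rho EC EG HC HG); auto;
      rewrite ids_par; apply in_or_app; auto. }
  revert C1; apply conn_realize; [split; auto|].
  intros e He; apply in_app_or in He as [He|He]; [|apply in_app_or in He as [He|He]]; auto.
  - assert (He' := He); apply coll_ids in HM as [_ HM].
    apply HM in He' as (a & b & -> & Ha & Hb); rewrite ids_par, in_app_iff in Ha, Hb.
    apply HRE; simpl; [|intros Q'; injection Q' as ->; tauto..].
    apply (Permutation_in _ (Permutation_sym HP)), in_or_app; auto.
  - assert (He' := He); apply coll_ids in HM as [HM _]; rewrite ids_par, in_app_iff in HM.
    apply (ctx_coll_ids _ _ _ HC) in He' as (a & b & -> & Ha & Hb).
    apply HRE; simpl; [|intros Q'; injection Q' as ->..].
    + apply (Permutation_in _ (Permutation_sym HP)), in_or_app; auto.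
    + destruct Ha as [->|Ha]; tauto.
    + destruct Hb as [->|Hb]; tauto.
Qed.

Lemma evolves_push_bot G C Q R m :
  evolves G (plug C (Tens (Par Q R) (Lf Bot m))) (plug C (Par Q (Tens R (Lf Bot m)))).
Proof.
  intros H; split; [apply push_bot_proof_graph, H|].
  apply rst_sym, rst_step; constructor; apply push_bot_side_cond, H.
Qed.

(** * Blocks *)

Fixpoint parfree (t : tree) : Prop :=
  match t with
  | Lf _ _ => True
  | Tens a b => parfree a /\ parfree b
  | Par _ _ => False
  end.

Definition block (t : tree) : Prop := linking t /\ parfree t.

(** Tensors keep both edges, so a block is connected in every switching by its own edges. *)
Lemma parfree_conn f sw t : parfree t -> forall p v, In v (tverts f p t) ->
  conn (tedges f sw p t) v (rootv f p t).
Proof.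
  induction t as [l i|a IHa b IHb|]; intros HP p v Hv; [|destruct HP as [Ha Hb]|destruct HP].
  - destruct Hv as [<-|[]]; apply rt_refl.
  - destruct Hv as [<-|Hv]; [apply rt_refl|]; apply in_app_or in Hv as [Hv|Hv].
    + apply conn_trans with (rootv f (p ++ [false]) a);
        [|apply conn_sym, conn_edge; simpl; auto].
      generalize (IHa Ha _ _ Hv); apply conn_incl; intros e He; simpl; rewrite in_app_iff; auto.
    + apply conn_trans with (rootv f (p ++ [true]) b);
        [|apply conn_sym, conn_edge; simpl; auto].
      generalize (IHb Hb _ _ Hv); apply conn_incl; intros e He; simpl; rewrite in_app_iff; auto.
Qed.

Lemma parfree_coll_conn nd t r E : coll nd t r E -> parfree t ->
  forall i, In i (ids t) -> conn E (VLeaf i) (VLeaf r).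
Proof.
  induction 1 as [l i|a b r1 r2 E1 E2 H1 IH1 H2 IH2|a b r1 r2 E1 E2 _ H1 IH1 H2 IH2| |];
    simpl; intros HP j Hj; try tauto; [destruct Hj as [<-|[]]; apply rt_refl|..];
    destruct HP as [Ha Hb]; rewrite ids_tens in Hj; apply in_app_or in Hj as [Hj|Hj];
    [apply (IH1 Ha) in Hj|apply (IH2 Hb) in Hj|apply (IH1 Ha) in Hj|apply (IH2 Hb) in Hj].
  1,4: revert Hj; apply conn_incl; intros e He; right; apply in_or_app; auto.
  all: eapply conn_trans; [|apply conn_sym, conn_edge; left; reflexivity];
    revert Hj; apply conn_incl; intros e He; right; apply in_or_app; auto.
Qed.

Definition cut_leaves (G : list item) (i j : nat) : Prop :=
  exists k l1 l2, nth_error G k = Some (Cut (Lf l1 i) (Lf l2 j)) \/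
                  nth_error G k = Some (Cut (Lf l2 j) (Lf l1 i)).

Lemma cut_leaves_sym G i j : cut_leaves G i j -> cut_leaves G j i.
Proof. intros (k & l1 & l2 & H); exists k, l2, l1; tauto. Qed.

Lemma cut_leaves_seq_coll G EG i j :
  seq_coll G EG -> cut_leaves G i j -> conn EG (VLeaf i) (VLeaf j).
Proof.
  intros HG (k & l1 & l2 & H); revert k H.
  induction HG as [|it G r E EG HE HG IH]; intros [|k] H; simpl in H;
    try (destruct H; discriminate).
  - assert (In (VLeaf i, VLeaf j) E \/ In (VLeaf j, VLeaf i) E) as HI.
    { destruct H as [H|H]; injection H as ->; simpl in HE; inversion HE; subst;
      repeat match goal with H : coll _ (Lf _ _) _ _ |- _ =>
        apply coll_leaf_inv in H as [-> ->] end; simpl; auto. }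
    apply (conn_incl E); [apply incl_appl, incl_refl|].
    destruct HI; [apply conn_edge|apply conn_sym, conn_edge]; auto.
  - apply IH in H; revert H; apply conn_incl, incl_appr, incl_refl.
Qed.

Lemma cut_leaves_sedges sw G i j : cut_leaves G i j ->
  forall k, conn (sedges sw k G) (VLeaf i) (VLeaf j).
Proof.
  intros (k & l1 & l2 & H); revert k H.
  induction G as [|it G IH]; intros [|k] H k'; simpl in H;
    try (destruct H; discriminate).
  - destruct H as [H|H]; injection H as ->; simpl;
      (apply conn_trans with (VG k' []); [apply conn_sym|]); apply conn_edge; simpl; auto.
  - simpl; generalize (IH _ H (S k')); apply conn_incl, incl_appr, incl_refl.
Qed.

(** Both blocks stay connected through the cut when the edge of the bottom is removed. *)
Lemma evolves_pull_bot G C B1 B2 m i j :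
  parfree B1 -> parfree B2 -> In i (ids B1) -> In j (ids B2) -> cut_leaves G i j ->
  evolves G (plug C (Par B1 (Tens B2 (Lf Bot m)))) (plug C (Tens (Par B1 B2) (Lf Bot m))).
Proof.
  intros F1 F2 Hi Hj Hc H; assert (W := proof_graph_well_formed _ _ H).
  destruct (well_formed_ids _ _ W) as [HN _].
  assert (Hm : ~ In m (ids B2)).
  { apply (Permutation_NoDup (ids_plug _ _)), NoDup_app_l in HN.
    rewrite ids_par, ids_tens in HN; apply NoDup_app_remove_l in HN.
    intros Hm; apply (NoDup_app_disjoint _ _ _ HN Hm); left; auto. }
  split.
  - assert (HT := proof_graph_all_trees _ _ H); apply all_trees_proof_graph.
    + eapply well_formed_plug; [exact W|exact I| |simpl; rewrite app_assoc; auto].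
      intros HX; inversion HX as [| | | | |? ? H1 H2]; subst.
      inversion H2 as [| | |? ? H3|? ? H3|]; subst; [inversion H3|].
      repeat constructor; auto.
    + intros R E EG HR HG.
      apply coll_plug_inv in HR as (rho & EC & r0 & E0 & HC & H0 & -> & HP).
      inversion H0 as [|? ? ? ? E12 ? H12 HB| | |]; subst; [|discriminate].
      apply coll_leaf_inv in HB as [-> ->].
      assert (HX : exists r1 r2 E1 E2, coll true B1 r1 E1 /\ coll true B2 r2 E2 /\
        E12 = E1 ++ E2 /\ (r0 = r1 \/ r0 = r2)).
      { inversion H12; subst; do 4 eexists; repeat split; eauto using coll_true. }
      destruct HX as (r1 & r2 & E1 & E2 & H1 & H2 & -> & Hr).
      assert (HB : coll true (Lf Bot m) m []) by constructor.
      assert (H3 := coll_tens_l _ _ _ _ _ _ _ H2 HB).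
      assert (HPar : coll true (Par B1 (Tens B2 (Lf Bot m))) r0
        (E1 ++ (VLeaf r2, VLeaf m) :: E2 ++ [])).
      { destruct Hr as [-> | ->]; [eapply coll_par_l|eapply coll_par_r]; eauto. }
      destruct (coll_plug _ _ _ HC _ _ _ HPar) as (E' & HE' & HP').
      assert (HT' := HT _ _ _ HE' HG).
      rewrite (tree_on_perm _ _ ((VLeaf r2, VLeaf m) :: E1 ++ E2 ++ EC r0 ++ EG)) in HT'
        by (rewrite HP'; perm).
      rewrite (tree_on_perm _ _ ((VLeaf r0, VLeaf m) :: E1 ++ E2 ++ EC r0 ++ EG))
        by (rewrite HP; perm).
      revert HT'; apply tree_on_exchange.
      destruct Hr as [-> | ->]; [|apply rt_refl].
      (* From [r2] to [j] inside [B2], through the cut to [i], and to [r1] inside [B1]. *)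
      apply conn_trans with (VLeaf j), conn_trans with (VLeaf i).
      * apply (conn_incl E2); [intros e; rewrite !in_app_iff; auto|].
        apply conn_sym, (parfree_coll_conn _ _ _ _ H2 F2), Hj.
      * apply (conn_incl EG); [intros e; rewrite !in_app_iff; auto|].
        apply conn_sym, cut_leaves_seq_coll with (G := G); auto.
      * apply (conn_incl E1); [intros e; rewrite !in_app_iff; auto|].
        apply (parfree_coll_conn _ _ _ _ H1 F1), Hi.
  - apply rst_step; constructor. intros sw v Hv HK.
    apply (bot_edge_bridge sw G C B1 B2 m H).
    destruct (bot_edge_equiv sw G C B1 B2 m) as [Kr Kt Ks].
    (* The same detour in the graph: from the tensor through [B2], the cut and [B1] to [v], and then
       to the bottom, bypassing a bridge. *)
    apply Kt with (1 := bot_edge_root_right sw G C B1 B2 m ltac:(intros i' Hi' ->; auto)).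
    eapply Kt; [apply Ks, bot_edge_right, (parfree_conn VP sw _ F2), ids_tverts, Hj|].
    eapply Kt.
    { apply Ks, (conn_realize _ _ ltac:(split; eauto) (bot_edge_sequent sw G C B1 B2 m)).
      apply cut_leaves_sedges, Hc. }
    eapply Kt; [apply bot_edge_left, (parfree_conn VP sw _ F1), ids_tverts, Hi|].
    eapply Kt; [apply Ks, bot_edge_left, (parfree_conn VP sw _ F1), Hv|exact HK].
Qed.

Inductive normal : tree -> Prop :=
| normal_block t : block t -> normal t
| normal_par s t : normal s -> normal t -> normal (Par s t).

Lemma evolves_inner G C D X Y :
  evolves G (plug (ccomp C D) X) (plug (ccomp C D) Y) ->
  evolves G (plug C (plug D X)) (plug C (plug D Y)).
Proof. rewrite !plug_ccomp; auto. Qed.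

(** The bottom settles on the rightmost block; everything to its left is carried along unchanged. *)
Lemma push_bot_normal G M m : normal M -> forall C,
  exists M', normal M' /\ evolves G (plug C (Tens M (Lf Bot m))) (plug C M').
Proof.
  induction 1 as [t [HL HF]|s t Hs _ _ IH]; intros C.
  - exists (Tens t (Lf Bot m)); split; [|apply evolves_refl].
    repeat constructor; auto.
  - destruct (IH (ccomp C (CPR s Hole))) as (t' & Ht' & He).
    exists (Par s t'); split; [apply normal_par; auto|].
    eapply evolves_trans; [apply evolves_push_bot|exact (evolves_inner _ _ _ _ _ He)].
Qed.

Lemma normalize G L : linking L -> forall C,
  exists L', normal L' /\ evolves G (plug C L) (plug C L').
Proof.
  induction 1 as [i|a i j|a i j|i L HL IH|i L HL IH|L M HL IHL HM IHM]; intros C.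
  1-3: eexists; split; [apply normal_block; split; [constructor|simpl; auto]|apply evolves_refl].
  1,2: destruct (IH (ccomp C (CTL Hole (Lf Bot i)))) as (L' & HL' & He);
    apply evolves_inner in He; destruct (push_bot_normal G _ i HL' C) as (M & HM & He');
    exists M; split; auto; eapply evolves_trans; [|exact He'].
  - eapply evolves_trans; [apply evolves_tens_comm|exact He].
  - exact He.
  - destruct (IHL (ccomp C (CPL Hole M))) as (L' & HL' & He).
    destruct (IHM (ccomp C (CPR L' Hole))) as (M' & HM' & He').
    apply evolves_inner in He, He'.
    exists (Par L' M'); split; [apply normal_par; auto|eapply evolves_trans; eauto].
Qed.

(** Commutativity and associativity of ⅋ rotate the block containing [x] to the front. The first
    alternative is the case where no other block remains beside it. *)
Lemma extract_block G T x : normal T -> In x (leaves T) -> forall C,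
  exists b, block b /\ In x (leaves b) /\
    (evolves G (plug C T) (plug C b) \/
     exists T', normal T' /\ evolves G (plug C T) (plug C (Par b T'))).
Proof.
  assert (S : forall s t, normal t ->
    (forall C, exists b, block b /\ In x (leaves b) /\
      (evolves G (plug C s) (plug C b) \/
       exists T', normal T' /\ evolves G (plug C s) (plug C (Par b T')))) ->
    forall C, exists b, block b /\ In x (leaves b) /\
       exists T', normal T' /\ evolves G (plug C (Par s t)) (plug C (Par b T'))).
  { intros s t Ht IH C; destruct (IH (ccomp C (CPL Hole t))) as (b & Hb & Hx & H).
    exists b; split; [exact Hb|split; [exact Hx|]].
    destruct H as [H|(T' & HT & H)]; apply evolves_inner in H; [exists t; auto|].
    exists (Par T' t); split; [apply normal_par; auto|].
    eapply evolves_trans; [exact H|apply evolves_par_assoc]. }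
  induction 1 as [t Ht|s t Hs IHs Ht IHt]; intros Hx C.
  - exists t; split; [exact Ht|split; [exact Hx|left; apply evolves_refl]].
  - apply in_app_or in Hx as [Hx|Hx].
    + destruct (S s t Ht (IHs Hx) C) as (b & Hb & Hxb & H); eauto.
    + destruct (S t s Hs (IHt Hx) C) as (b & Hb & Hxb & T' & HT & H).
      exists b; split; [exact Hb|split; [exact Hxb|right; exists T'; split; auto]].
      eapply evolves_trans; [apply evolves_par_comm|exact H].
Qed.

(** The block already joins both leaves by linking edges, so the cut between them would close a
    cycle. *)
Lemma block_no_cut G C b i j : proof_graph (plug C b) G -> parfree b ->
  cut_leaves G i j -> In i (ids b) -> In j (ids b) -> False.
Proof.
  intros H Hb Hc Hi Hj; apply proof_graph_all_trees in H.
  destruct (tcoll_exists VP (fun _ => true) (plug C b) []) as (r & E & HE).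
  apply tcoll_coll, coll_plug_inv in HE as (rho & EC & r0 & E0 & HC & H0 & -> & HP).
  apply coll_true in H0; destruct (coll_plug _ _ _ HC _ _ _ H0) as (E' & HE' & HP').
  destruct (seq_tcoll_exists (fun _ => true) G 0) as [EG HG]; apply seq_tcoll_coll in HG.
  destruct (H _ _ _ HE' HG) as [_ HF].
  assert (Hij : conn E' (VLeaf i) (VLeaf j)).
  { apply (conn_incl E0).
    - intros e He; apply (Permutation_in _ (Permutation_sym HP')), in_or_app; auto.
    - eapply conn_trans; [|apply conn_sym]; eapply parfree_coll_conn; eauto. }
  destruct Hc as (k & l1 & l2 & Hk).
  assert (HI : exists EG', Permutation EG ((VLeaf i, VLeaf j) :: EG') \/
                      Permutation EG ((VLeaf j, VLeaf i) :: EG')).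
  { clear - HG Hk; revert k Hk; induction HG as [|it G r E EG HE HG IH];
      intros [|k] Hk; simpl in Hk; try (destruct Hk; discriminate).
    - destruct Hk as [Hk|Hk]; injection Hk as ->; simpl in HE; inversion HE; subst;
      repeat match goal with H : coll _ (Lf _ _) _ _ |- _ =>
        apply coll_leaf_inv in H as [-> ->] end; simpl; eauto.
    - destruct (IH k Hk) as [EG' [H|H]]; exists (E ++ EG'); rewrite H; [left|right]; perm. }
  destruct HI as [EG' HI].
  assert (HB : exists u v, ((u = VLeaf i /\ v = VLeaf j) \/ (u = VLeaf j /\ v = VLeaf i)) /\
    Permutation (E' ++ EG) ((u, v) :: E' ++ EG')).
  { destruct HI as [HI|HI]; [exists (VLeaf i), (VLeaf j)|exists (VLeaf j), (VLeaf i)];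
      (split; [auto|rewrite HI; perm]). }
  destruct HB as (u & v & Huv & HB); apply (forest_bridge _ _ _ _ HF HB).
  apply (conn_incl E'); [apply incl_appl, incl_refl|].
  destruct Huv as [[-> ->]|[-> ->]]; [|apply conn_sym]; exact Hij.
Qed.

(** * Stripping blocks down to the links of the cut leaves *)

Inductive core : lit * nat -> tree -> Prop :=
| core_one i : core (One, i) (Lf One i)
| core_pos_l a i j : core (Pos a, i) (Tens (Lf (Pos a) i) (Lf (Neg a) j))
| core_pos_r a i j : core (Pos a, i) (Tens (Lf (Neg a) j) (Lf (Pos a) i))
| core_neg_l a i j : core (Neg a, i) (Tens (Lf (Neg a) i) (Lf (Pos a) j))
| core_neg_r a i j : core (Neg a, i) (Tens (Lf (Pos a) j) (Lf (Neg a) i))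
| core_bot Q i : core (Bot, i) (Tens Q (Lf Bot i)).

Lemma in_leaves_ids l i t : In (l, i) (leaves t) -> In i (ids t).
Proof. apply (in_map snd _ (l, i)). Qed.

Lemma core_leaf x b : core x b -> In (snd x) (ids b).
Proof. destruct 1; rewrite ?ids_tens; simpl; auto; apply in_or_app; right; left; auto. Qed.

(** Each bottom lying above the leaf [j] is pulled out into the context, as the cut to [B1] permits.
    The descent ends at the link of [j], or at a tensor whose bottom is [j] itself; there [Q]
    remains arbitrary, as in the redex of the unit step. *)
Lemma strip_block G i j l B1 B2 : cut_leaves G i j -> parfree B1 -> In i (ids B1) ->
  linking B2 -> parfree B2 -> In (l, j) (leaves B2) -> forall C,
  exists C' b, core (l, j) b /\ parfree b /\
    evolves G (plug C (Par B1 B2)) (plug C' (Par B1 b)).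
Proof.
  intros Hc F1 Hi HL;
    induction HL as [i0|a i0 j0|a i0 j0|m L HL IH|m L HL IH|L M]; intros F2 Hj C.
  1-3: exists C; eexists; split; [|split; [exact F2|apply evolves_refl]];
    simpl in Hj; repeat destruct Hj as [Hj|Hj]; try contradiction;
    injection Hj as <- <-; constructor.
  3: destruct F2.
  (* [es_par_bot] handles a bottom on the right; one on the left is first commuted there. *)
  all: assert (HR : parfree L -> In (l, j) (leaves (Tens L (Lf Bot m))) ->
    exists C' b, core (l, j) b /\ parfree b /\
    evolves G (plug C (Par B1 (Tens L (Lf Bot m)))) (plug C' (Par B1 b))).
  1,3: clear F2 Hj; intros F2 Hj; apply in_app_or in Hj as [Hj|[Hj|[]]];
    [destruct (IH F2 Hj (ccomp C (CTL Hole (Lf Bot m)))) as (C' & b & Hb & Fb & He);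
     exists C', b; split; [exact Hb|split; [exact Fb|]];
     rewrite plug_ccomp in He; eapply evolves_trans; [|exact He];
     eapply evolves_pull_bot; eauto using in_leaves_ids
    |injection Hj as <- <-; exists C, (Tens L (Lf Bot m)); split; [constructor|];
     split; [simpl; auto|apply evolves_refl]].
  - destruct HR as (C' & b & Hb & Fb & He); [apply F2|simpl in *; rewrite in_app_iff; simpl; tauto|].
    exists C', b; split; [exact Hb|split; [exact Fb|]].
    eapply evolves_trans; [|exact He].
    apply (evolves_inner G C (CPR B1 Hole)), evolves_tens_comm.
  - apply HR; [apply F2|exact Hj].
Qed.

Lemma bring_together G P l1 i l2 j : proof_graph P G -> cut_leaves G i j ->
  In (l1, i) (leaves P) -> In (l2, j) (leaves P) ->
  exists C b1 b2, core (l1, i) b1 /\ core (l2, j) b2 /\ evolves G P (plug C (Par b1 b2)).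
Proof.
  intros HP Hc Hi Hj.
  assert (HL : forall P' x, evolves G P P' -> In x (leaves P) -> In x (leaves P')).
  { intros P' x He Hx; destruct (He HP) as [(_ & _ & _ & H' & _) _].
    destruct HP as (_ & _ & _ & H & _).
    apply (Permutation_in _ (Permutation_sym H')), (Permutation_in _ H), Hx. }
  destruct (normalize G P (proj1 HP) Hole) as (T & HT & E1); simpl in E1.
  destruct (extract_block G T (l1, i) HT (HL _ _ E1 Hi) Hole) as (b1 & Hb1 & Hi1 & HE);
    simpl in HE.
  assert (N : forall C, evolves G P (plug C b1) -> ~ In (l2, j) (leaves b1)).
  { intros C He Hj1; destruct (He HP) as [H _]; apply in_leaves_ids in Hi1, Hj1.
    exact (block_no_cut _ _ _ _ _ H (proj2 Hb1) Hc Hi1 Hj1). }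
  destruct HE as [E2|(T1 & HT1 & E2)]; assert (E3 := evolves_trans _ _ _ _ E1 E2).
  { destruct (N Hole E3 (HL _ _ E3 Hj)). }
  assert (Hj1 := HL _ _ E3 Hj); apply in_app_or in Hj1 as [Hj1|Hj1];
    [destruct (N (CPL Hole T1) E3 Hj1)|].
  destruct (extract_block G T1 (l2, j) HT1 Hj1 (CPR b1 Hole)) as (b2 & Hb2 & Hj2 & HE).
  assert (HC : exists C, evolves G P (plug C (Par b1 b2))).
  { destruct HE as [E4|(T2 & HT2 & E4)]; assert (E5 := evolves_trans _ _ _ _ E3 E4).
    - exists Hole; exact E5.
    (* Regrouping of b1 ⅋ (b2 ⅋ T2) as T2 ⅋ (b1 ⅋ b2) through (b2 ⅋ T2) ⅋ b1, b2 ⅋ (T2 ⅋ b1) and (T2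
       ⅋ b1) ⅋ b2. *)
    - exists (CPR T2 Hole).
      apply (evolves_trans _ _ _ _ E5), (evolves_trans _ _ _ _ (evolves_par_comm G Hole _ _)).
      apply (evolves_trans _ _ _ _ (evolves_par_assoc G Hole _ _ _)).
      apply (evolves_trans _ _ _ _ (evolves_par_comm G Hole _ _)).
      apply (evolves_par_assoc G Hole). }
  destruct HC as [C E4].
  destruct (strip_block G i j l2 b1 b2 Hc (proj2 Hb1) (in_leaves_ids _ _ _ Hi1)
    (proj1 Hb2) (proj2 Hb2) Hj2 C) as (C' & c2 & Hc2 & F2 & E5).
  (* Same argument with the roles exchanged: the stripped [c2] is still ⅋-free and still contains
     [j], so the cut keeps joining the pair. *)
  destruct (strip_block G j i l1 c2 b1 (cut_leaves_sym _ _ _ Hc) F2 (core_leaf _ _ Hc2)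
    (proj1 Hb1) (proj2 Hb1) Hi1 C') as (C'' & c1 & Hc1 & F1 & E6).
  exists C'', c1, c2; split; [exact Hc1|split; [exact Hc2|]].
  eapply evolves_trans; [exact E4|]. eapply evolves_trans; [exact E5|].
  eapply evolves_trans; [apply evolves_par_comm|].
  eapply evolves_trans; [exact E6|apply evolves_par_comm].
Qed.

(** * Readiness of unit, atomic and compound cuts *)

Lemma ready_unit G k A B i j P :
  proof_graph P G -> nth_error G k = Some (Cut A B) ->
  (A = Lf Bot i /\ B = Lf One j) \/ (A = Lf One j /\ B = Lf Bot i) ->
  In (Bot, i) (leaves P) -> In (One, j) (leaves P) ->
  exists P', proof_graph P' G /\ pg_equiv G P P' /\ ready P' G k.
Proof.
  intros HP Hk HAB Hi Hj.
  assert (Hc : cut_leaves G i j).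
  { exists k, Bot, One; destruct HAB as [[-> ->]|[-> ->]]; auto. }
  destruct (bring_together G P Bot i One j HP Hc Hi Hj) as (C & b1 & b2 & H1 & H2 & He).
  inversion H1; inversion H2; subst; destruct (He HP) as [HP' HE].
  eexists; split; [exact HP'|split; [exact HE|]].
  exists A, B; split; [exact Hk|right; right; exists i, j; split; [exact HAB|eauto]].
Qed.

Lemma ready_atom G k A B a i j P :
  proof_graph P G -> nth_error G k = Some (Cut A B) ->
  (A = Lf (Pos a) i /\ B = Lf (Neg a) j) \/ (A = Lf (Neg a) j /\ B = Lf (Pos a) i) ->
  In (Pos a, i) (leaves P) -> In (Neg a, j) (leaves P) ->
  exists P', proof_graph P' G /\ pg_equiv G P P' /\ ready P' G k.
Proof.
  intros HP Hk HAB Hi Hj.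
  assert (Hc : cut_leaves G i j).
  { exists k, (Pos a), (Neg a); destruct HAB as [[-> ->]|[-> ->]]; auto. }
  destruct (bring_together G P _ i _ j HP Hc Hi Hj) as (C & b1 & b2 & H1 & H2 & He).
  (* Axiom links may come in either orientation; the redex has the negative atom on the left of
     both. *)
  assert (N1 : exists h, evolves G P
    (plug C (Par (Tens (Lf (Neg a) h) (Lf (Pos a) i)) b2))).
  { inversion H1 as [|? ? h| ? ? h| | |]; subst; exists h; [|exact He].
    eapply evolves_trans; [exact He|].
    apply (evolves_inner G C (CPL Hole b2)), evolves_tens_comm. }
  destruct N1 as [h N1].
  assert (N2 : exists l, evolves G P (plug C (Par (Tens (Lf (Neg a) h) (Lf (Pos a) i))
    (Tens (Lf (Neg a) j) (Lf (Pos a) l))))).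
  { inversion H2 as [| | |? ? l|? ? l|]; subst; exists l; [exact N1|].
    eapply evolves_trans; [exact N1|].
    apply (evolves_inner G C (CPR _ Hole)), evolves_tens_comm. }
  destruct N2 as [l N2], (N2 HP) as [HP' HE].
  eexists; split; [exact HP'|split; [exact HE|]].
  exists A, B; split; [exact Hk|right; left; exists a, i, j; split; [exact HAB|]].
  do 3 eexists; reflexivity.
Qed.

Theorem theorem1p16 (P : tree) (G : list item) (k : nat) (A B : tree) :
  proof_graph P G ->
  nth_error G k = Some (Cut A B) ->
  exists P' : tree, proof_graph P' G /\ pg_equiv G P P' /\ ready P' G k.
Proof.
  intros HP Hk; assert (HP' := HP); destruct HP' as (_ & HW & _ & HL & _).
  assert (HG := nth_error_In _ _ Hk).
  assert (HD : dualf A B) by exact (proj1 (Forall_forall _ _) HW _ HG).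
  assert (HI : forall x, In x (leaves A ++ leaves B) -> In x (leaves P)).
  { intros x Hx; apply (Permutation_in _ (Permutation_sym HL)), in_flat_map; eauto. }
  (* Duality leaves six shapes. A compound cut is ready in [P] itself, because its reduction makes
     no demand on the linking. *)
  destruct A as [[a|a| |] i|A1 A2|A1 A2], B as [[b|b| |] j|B1 B2|B1 B2];
    simpl in HD; try contradiction; try subst b.
  - eapply (ready_atom G k _ _ a i j); eauto; apply HI; simpl; auto.
  - eapply (ready_atom G k _ _ a j i); eauto; apply HI; simpl; auto.
  - eapply (ready_unit G k _ _ j i); eauto; apply HI; simpl; auto.
  - eapply (ready_unit G k _ _ i j); eauto; apply HI; simpl; auto.
  - exists P; split; [exact HP|split; [apply rst_refl|]].
    do 2 eexists; split; [exact Hk|left; do 4 eexists; right; split; reflexivity].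
  - exists P; split; [exact HP|split; [apply rst_refl|]].
    do 2 eexists; split; [exact Hk|left; do 4 eexists; left; split; reflexivity].
Qed.
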